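(* Let $(X,G)$ be a $G$-system and let $\{F_n\}$ be a tempered Følner sequence of $G$ satisfying $$e_G\in F_1\subseteq F_2\subseteq\cdots,\quad \lim_{n\to\infty}\frac{|F_n|}{\log n}=\infty,\quad \lim_{n\to\infty}\frac{|F_{n+1}|}{|F_n|}=1,\quad G=\bigcup_{n\in\mathbb N}F_n.$$ Then $(X,G)$ is asymptotically $h$-expansive if and only if it is hereditarily uniformly lowerable along $\{F_n\}$.
   Context: A $G$-system $(X,G)$ is a compact metric space $X$ with a countably infinite discrete amenable group $G$ (identity $e_G$) acting continuously on $X$ by homeomorphisms. A Følner sequence is a sequence $\{F_n\}$ of nonempty finite subsets of $G$ with $|F_n\triangle sF_n|/|F_n|\to0$ for every $s\in G$; it is tempered if there is $C>0$ with $|\bigcup_{k<n}F_k^{-1}F_n|\le C|F_n|$ for all $n>1$. For a finite cover $\mathcal U$ and finite $F\subseteq G$, $\mathcal U_F=\bigvee_{g\in F}g^{-1}\mathcal U$; $N(\mathcal U,K)$ is the minimal cardinality of a subfamily of $\mathcal U$ whose union contains $K$. For $K\subseteq X$, $h_{\mathrm{top}}(K,\{F_n\})=\sup_{\mathcal U}\limsup_n\frac1{|F_n|}\log N(\mathcal U_{F_n},K)$ over finite open covers $\mathcal U$ of $X$. Tail entropy: for finite open covers $\mathcal U,\mathcal V$ of $X$, $N(\mathcal U|\mathcal V)=\sup_{V\in\mathcal V}N(\mathcal U,V)$, $h_{\mathrm{top}}(G,\mathcal U|\mathcal V)=\lim_n\frac1{|F_n|}\log N(\mathcal U_{F_n}|\mathcal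 V_{F_n})$ (independent of the Følner sequence), and $h^*_{\mathrm{top}}(X,G)=\inf_{\mathcal V}\sup_{\mathcal U}h_{\mathrm{top}}(G,\mathcal U|\mathcal V)$. $(X,G)$ is asymptotically $h$-expansive if $h^*_{\mathrm{top}}(X,G)=0$. $(X,G)$ is hereditarily uniformly lowerable along $\{F_n\}$ if for every nonempty compact $K\subseteq X$ and every $0\le h\le h_{\mathrm{top}}(K,\{F_n\})$ there is a nonempty compact $K_h\subseteq K$ with at most one limit point such that $h_{\mathrm{top}}(K_h,\{F_n\})=h$. *)

(* Defs.v *)
From HB Require Import structures.
From mathcomp Require Import all_boot all_order all_algebra finmap.
From mathcomp Require Import all_classical all_reals all_analysis.

Set Implicit Arguments.
Unset Strict Implicit.
Unset Printing Implicit Defensive.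

Import Order.TTheory GRing.Theory Num.Theory.
Import numFieldNormedType.Exports.

Local Open Scope classical_set_scope.
Local Open Scope ring_scope.

Section FolnerSequences.
Context {G : groupType}.
Implicit Types (s : G) (E F : {fset G}) (Fn : nat -> {fset G}).

Definition ltranslate s F : {fset G} := [fset (s * g)%g | g in F]%fset.

Definition symdiff E F : {fset G} := ((E `\` F) `|` (F `\` E))%fset.

Definition invmul E F : {fset G} := [fset (a^-1 * b)%g | a in E, b in F]%fset.

(* Sequences are indexed from 0: [Fn n] is the (n+1)-st set of the sequence. *)
Definition folner (R : realType) Fn : Prop :=
  (forall n, Fn n != fset0) /\
  (forall s, (fun n => #|` symdiff (Fn n) (ltranslate s (Fn n))|%:R
                       / #|` Fn n|%:R : R) @ \oo --> (0 : R)).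

Definition tempered (R : realType) Fn : Prop :=
  exists2 C : R, 0 < C & forall n, (0 < n)%N ->
    #|` \big[fsetU/fset0]_(k < n) invmul (Fn k) (Fn n)|%:R <= C * #|` Fn n|%:R.

End FolnerSequences.

(* For countable groups: existence of a Folner sequence. *)
Definition amenable (R : realType) (G : groupType) : Prop :=
  exists Fn : nat -> {fset G}, folner R Fn.

(* As [G] is discrete, joint continuity of the action means continuity of each
   [act g]; each [act g] is then a homeomorphism with inverse [act g^-1]. *)
Definition continuous_action (G : groupType) (X : topologicalType)
    (act : G -> X -> X) : Prop :=
  [/\ forall x, act 1%g x = x,
      forall g h x, act (g * h)%g x = act g (act h x)
    & forall g, continuous (act g)].

Section Covers.
Context {X : topologicalType}.
Implicit Types (U V : {fset set X}) (K : set X).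

Definition open_cover U : Prop :=
  (forall A, A \in U -> open A) /\ \bigcup_(A in [set` U]) A = setT.

(* The minimum runs over all subfamilies [W] of [U] that cover [K]; the initial
   value is harmless since [U] itself covers [K] whenever [U] covers [X]. *)
Definition cover_num U K : nat :=
  \big[minn/#|` U|]_(W <- fpowerset U | `[< K `<=` \bigcup_(A in [set` W]) A >])
     #|` W|.

Definition cond_cover_num U V : nat := \max_(A <- V) cover_num U A.

Definition cover_join U V : {fset set X} :=
  [fset (A `&` B)%classic | A in U, B in V]%fset.

Definition cover_preimage (f : X -> X) U : {fset set X} :=
  [fset (f @^-1` A)%classic | A in U]%fset.

End Covers.

Section Entropy.
Context {R : realType} {G : groupType} {X : topologicalType}.
Variables (act : G -> X -> X) (Fn : nat -> {fset G}).
Implicit Types (U V : {fset set X}) (K : set X) (F : {fset G}).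

Definition dyn_join U F : {fset set X} :=
  \big[@cover_join X/[fset [set: X]]%fset]_(g <- F) cover_preimage (act g) U.

Definition htop K : \bar R :=
  ereal_sup [set limn_esup (fun n =>
      ((#|` Fn n|%:R)^-1 * ln (cover_num (dyn_join U (Fn n)) K)%:R)%:E)
    | U in @open_cover X].

(* For a Folner sequence the limit exists and does not depend on the sequence
   (Ornstein-Weiss); [ln] is only applied to positive numbers unless [X] is
   empty, where [ln 0 = 0]. *)
Definition htop_cond U V : \bar R :=
  limn (fun n => ((#|` Fn n|%:R)^-1 *
    ln (cond_cover_num (dyn_join U (Fn n)) (dyn_join V (Fn n)))%:R)%:E : \bar R).

Definition tail_entropy : \bar R :=
  ereal_inf [set ereal_sup [set htop_cond U V | U in @open_cover X]
            | V in @open_cover X].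

Definition asymptotically_h_expansive : Prop := tail_entropy = 0%E.

(* [h] ranges over the extended reals, as [htop K] may be infinite. *)
Definition hereditarily_uniformly_lowerable : Prop :=
  forall K, compact K -> K !=set0 ->
  forall h : \bar R, (0 <= h)%E -> (h <= htop K)%E ->
  exists Kh : set X,
    [/\ compact Kh, Kh !=set0, Kh `<=` K,
        is_subset1 (limit_point Kh) & htop Kh = h].

End Entropy.

Arguments asymptotically_h_expansive R {G X} act Fn.
Arguments hereditarily_uniformly_lowerable R {G X} act Fn.

(* Main.v *)
Require Import Defs.
From HB Require Import structures.
From mathcomp Require Import all_boot all_order all_algebra finmap.
From mathcomp Require Import all_classical all_reals all_analysis.
From mathcomp Require Import ring lra.
Import Order.TTheory GRing.Theory Num.Theory.
Import numFieldNormedType.Exports.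
Local Open Scope classical_set_scope.
Local Open Scope ring_scope.

Set Implicit Arguments.
Unset Strict Implicit.
Unset Printing Implicit Defensive.

(* The complexity of [K] over [E] is the least number of itineraries in a cover that
   the points of [K] follow over [E].  A Folner set is filled, up to a small
   proportion, by almost disjoint right translates of smaller Folner sets (the
   quasi-tilings of Ornstein and Weiss), so a bound on the complexity along the tiles
   gives one along the whole set.  This yields the existence of the limit defining
   the conditional entropy, and also holds when the tiles depend on the orbit, since
   there are few choices for the centres of large tiles.

   If the tail entropy is zero, choose a point [x] of [K] all of whose neighbourhoods
   have entropy at least [h].  Near [x], stop at the first time at which the
   complexity exceeds [e^(h|F_n|)] and keep that many separated points: finite sets
   obtained in this way and converging to [x] have entropy at most [h] together, and
   at least [h] because one scale controls the finer ones up to the tail entropy.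

   If the tail entropy is positive then, for some [b > 0] and every [V], some [U]
   admits infinitely many points near which sets following a common itinerary in [V]
   for a very long time have complexity at least [e^(b|F_n|)] in [U].  Such sets
   accumulate at points [u_j], and lowerability cuts them down to sets [S_j], with
   the single limit point [u_j], whose entropy increases strictly to [b], while they
   are trivial at coarse scales.  Take the [u_j] distinct and converging to [x].  In
   the union of [x] and the [S_j], a set with one limit point is either covered by
   finitely many [S_j] up to [x], or finite in each [S_j], and then of entropy 0. *)

(** * Cover numbers and itineraries *)

Section CoverNumbers.
Context {X : topologicalType}.
Implicit Types (U V W : {fset set X}) (K : set X).

Lemma bigminn_le (I : eqType) (x0 : nat) (s : seq I) (P : pred I) (f : I -> nat)
    (i : I) :
  i \in s -> P i -> (\big[minn/x0]_(j <- s | P j) f j <= f i)%N.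
Proof.
elim: s => [//|j s IHs]; rewrite in_cons big_cons => /predU1P[-> Pj|/IHs{}IHs Pi].
  by rewrite Pj geq_minl.
by case: ifP => _; [exact/(leq_trans (geq_minr _ _))/IHs|exact: IHs].
Qed.

Lemma bigminn_attained (I : eqType) (x0 : nat) (s : seq I) (P : pred I)
    (f : I -> nat) :
  \big[minn/x0]_(j <- s | P j) f j = x0 \/
  exists i, [/\ i \in s, P i & \big[minn/x0]_(j <- s | P j) f j = f i].
Proof.
elim: s => [|j s IHs]; first by left; rewrite big_nil.
rewrite big_cons; case: ifP => Pj; last first.
  by case: IHs => [->|[i [si Pi ->]]]; [left|right; exists i; rewrite in_cons si orbT].
rewrite /minn; case: ifP => _; first by right; exists j; rewrite mem_head.
by case: IHs => [->|[i [si Pi ->]]]; [left|right; exists i; rewrite in_cons si orbT].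
Qed.

Lemma cover_num_le U W K : (W `<=` U)%fset ->
  K `<=` \bigcup_(A in [set` W]) A -> (cover_num U K <= #|` W|)%N.
Proof.
by move=> WU KW; apply: bigminn_le; [rewrite fpowersetE|exact/asboolP].
Qed.

Lemma cover_num_attained U K : K `<=` \bigcup_(A in [set` U]) A ->
  exists W, [/\ (W `<=` U)%fset, K `<=` \bigcup_(A in [set` W]) A
              & #|` W| = cover_num U K].
Proof.
move=> KU.
have [e|[W [WU /asboolP KW e]]] := bigminn_attained #|` U| (fpowerset U)
  (fun W => `[< K `<=` \bigcup_(A in [set` W]) A >]) (fun W => #|` W|).
  by exists U; split => //; rewrite -e.
by exists W; rewrite -fpowersetE.
Qed.

End CoverNumbers.

Section NameCounting.
Context {G : groupType} {X : topologicalType} (act : G -> X -> X).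
Implicit Types (U V : {fset set X}) (E : {fset G}) (K Y : set X).

Definition covers U : Prop := \bigcup_(A in [set` U]) A = setT.

Lemma open_cover_covers U : open_cover U -> covers U.
Proof. by case. Qed.

Lemma coversP U (UT : covers U) (x : X) : exists2 A, A \in U & A x.
Proof. by have : [set: X] x by []; rewrite -UT => -[A]; exists A. Qed.

(** Itineraries are total functions on [G], so that they restrict, translate and glue freely; only
    their values on [E] matter. *)
Definition name_set E (w : G -> set X) : set X :=
  [set y | forall g, g \in E -> w g (act g y)].

Lemma mem_dyn_join U E A : A \in dyn_join act U E <->
  exists2 w, (forall g, g \in E -> w g \in U) & A = name_set E w.
Proof.
(* The itinerary is redefined at the head [g] alone; as the sequence has no duplicates, its values
   on the tail are unchanged. *)
suff aux (s : seq G) B : uniq s ->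
  B \in \big[@cover_join X/[fset [set: X]]%fset]_(g <- s) cover_preimage (act g) U
  <-> exists2 w, (forall g, g \in s -> w g \in U) &
      B = [set y | forall g, g \in s -> w g (act g y)].
  by rewrite /dyn_join aux ?fset_uniq.
elim: s B => [|g s IHs] B; rewrite ?big_nil ?big_cons.
  move=> _; rewrite inE; split.
    by move=> /eqP ->; exists (fun=> setT) => //; apply/seteqP; split.
  by move=> [w _ ->]; apply/eqP/seteqP; split.
move=> /andP[gs /IHs{}IHs]; split.
  move=> /imfset2P[/= _ /imfsetP[/= A0 A0U ->]] [C /IHs[w wU ->] ->].
  exists (fun h => if h == g then A0 else w h).
    move=> h; rewrite in_cons; case: eqP => //= _; exact: wU.
  apply/seteqP; split=> [y [yA yw] h|y yw].
    by rewrite in_cons; case: eqP => [->//|_ /=]; exact: yw.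
  split; first by have := yw g (mem_head _ _); rewrite eqxx.
  move=> h hs; have := yw h; rewrite in_cons hs orbT; case: eqP => [hg|_]; last exact.
  by move: gs; rewrite -hg hs.
move=> [w wU ->].
apply/imfset2P; exists (act g @^-1` w g)%classic.
  by apply/imfsetP; exists (w g) => //; apply: wU; rewrite mem_head.
exists [set y | forall h, h \in s -> w h (act h y)].
  by apply/IHs; exists w => // h hs; apply: wU; rewrite in_cons hs orbT.
apply/seteqP; split=> [y yw|y [yg yw] h].
  by split=> [|h hs]; apply: yw; rewrite in_cons ?eqxx// hs orbT.
by rewrite in_cons => /predU1P[->//|]; exact: yw.
Qed.

Definition ncov U E K : nat := cover_num (dyn_join act U E) K.

(** With its converse [ncov_names], this trades minimal subcovers for finite families of
    itineraries, in which repetitions and empty name sets are harmless. The counting below rests on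
    these two facts. *)
Lemma ncov_le (I : finType) (w : I -> G -> set X) U E K :
  (forall i g, g \in E -> w i g \in U) ->
  (forall y, K y -> exists i, name_set E (w i) y) ->
  (ncov U E K <= #|I|)%N.
Proof.
move=> wU Kw.
apply: (@leq_trans #|` [fset name_set E (w i) | i in I]%fset|).
  apply: cover_num_le.
    apply/fsubsetP => _ /imfsetP[/= i _ ->].
    by apply/mem_dyn_join; exists (w i) => // g; exact: wU.
  move=> y /Kw[i yi]; exists (name_set E (w i)) => //.
  by apply/imfsetP; exists i.
rewrite (leq_trans (leq_imfset_card _ _ _))// cardE.
by rewrite uniq_leq_size ?enum_finmem_uniq// => i _; rewrite mem_enum.
Qed.

Lemma covers_dyn_join U E : covers U -> covers (dyn_join act U E).
Proof.
move=> UT; apply/seteqP; split => // y _.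
have /choice[w wP] : forall g, exists A, A \in U /\ A (act g y).
  by move=> g; have [A AU Ay] := coversP UT (act g y); exists A.
exists (name_set E w) => [|g _]; last by have [] := wP g.
by apply/mem_dyn_join; exists w => // g _; have [] := wP g.
Qed.

Lemma ncov_names U E K : covers U ->
  exists2 w : 'I_(ncov U E K) -> G -> set X,
    (forall i g, g \in E -> w i g \in U) &
    (forall y, K y -> exists i, name_set E (w i) y).
Proof.
move=> UT.
have KU : K `<=` \bigcup_(A in [set` dyn_join act U E]) A.
  by rewrite (covers_dyn_join E UT).
have [W [WU KW cW]] := cover_num_attained KU; rewrite /ncov -cW.
have /choice[w wP] : forall i : 'I_#|` W|, exists w,
    (forall g, g \in E -> w g \in U) /\ nth set0 W i = name_set E w.
  move=> i; have /(fsubsetP WU)/mem_dyn_join[w wU e] : nth set0 W i \in W.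
    exact: mem_nth.
  by exists w.
exists w => [i|y /KW[A /= AW Ay]]; first by have [] := wP i.
have iW : (index A W < #|` W|)%N by rewrite index_mem.
by exists (Ordinal iW); have [_ <-] := wP (Ordinal iW); rewrite nth_index.
Qed.

Lemma ncov_sub U E K Y : covers U -> K `<=` Y -> (ncov U E K <= ncov U E Y)%N.
Proof.
move=> UT KY; have [w wU wP] := ncov_names E Y UT.
by rewrite -[leqRHS]card_ord; apply: ncov_le wU _ => y /KY/wP.
Qed.

Lemma ncov_bigcup (I : finType) (Y : I -> set X) U E K : covers U ->
  (forall y, K y -> exists i, Y i y) ->
  (ncov U E K <= \sum_i ncov U E (Y i))%N.
Proof.
move=> UT KY.
pose w i := s2val (cid2 (ncov_names E (Y i) UT)).
have wU i : forall j g, g \in E -> w i j g \in U := s2valP (cid2 (ncov_names E (Y i) UT)).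
have wP i : forall y, Y i y -> exists j, name_set E (w i j) y :=
  s2valP' (cid2 (ncov_names E (Y i) UT)).
pose J := {i : I & 'I_(ncov U E (Y i))}.
have -> : (\sum_i ncov U E (Y i) = #|{: J}|)%N.
  by rewrite card_tagged sumnE big_map big_enum; apply: eq_bigr => i _; rewrite card_ord.
apply: (@ncov_le J (fun p => w (tag p) (tagged p))) => [[i j]|y /KY[i /wP[j yj]]].
  exact: wU.
by exists (Tagged (fun i => 'I_(ncov U E (Y i))) j).
Qed.

Lemma ncovU U E K Y : covers U -> (ncov U E (K `|` Y) <= ncov U E K + ncov U E Y)%N.
Proof.
move=> UT; apply: leq_trans (@ncov_bigcup bool (fun b => if b then K else Y) U E _ UT _) _.
  by move=> y [|]; [exists true|exists false].
by rewrite big_bool.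
Qed.

(** Itineraries over [E] and over [E'] are glued in pairs; on the overlap the first one is kept. *)
Lemma ncov_setU U E E' K : covers U ->
  (ncov U (E `|` E')%fset K <= ncov U E K * ncov U E' K)%N.
Proof.
move=> UT; have [w wU wP] := ncov_names E K UT; have [v vU vP] := ncov_names E' K UT.
rewrite -[X in (_ <= X * _)%N]card_ord -[X in (_ <= _ * X)%N]card_ord -card_prod.
apply: (@ncov_le _ (fun p g => if g \in E then w p.1 g else v p.2 g)).
  move=> [i j] g /=; rewrite in_fsetU; case: ifP => [/wU//|_ /= /vU//].
move=> y Ky; have [i yi] := wP y Ky; have [j yj] := vP y Ky.
exists (i, j) => g /=; rewrite in_fsetU; case: ifP => [/yi//|_ /= /yj//].
Qed.

Definition rtrans E (c : G) : {fset G} := [fset (g * c)%g | g in E]%fset.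

Lemma mem_rtrans E (c h : G) : (h \in rtrans E c) = ((h * c^-1)%g \in E).
Proof.
apply/imfsetP/idP => [[g /= gE ->]|hE]; first by rewrite mulgK.
by exists (h * c^-1)%g => //; rewrite mulgVK.
Qed.

Lemma card_rtrans E (c : G) : #|` rtrans E c| = #|` E|.
Proof. by rewrite card_imfset//; exact: mulIg. Qed.

(** Following [w] over [E] from [act c y] amounts to following a translate of [w] over [E c] from
    [y]; this is why tiles are right translates. *)
Lemma ncov_rtrans U E (c : G) K : covers U ->
  (forall g h x, act (g * h)%g x = act g (act h x)) ->
  (ncov U (rtrans E c) K <= ncov U E [set act c y | y in K])%N.
Proof.
move=> UT actM; have [w wU wP] := ncov_names E [set act c y | y in K] UT.
rewrite -[leqRHS]card_ord; apply: (@ncov_le _ (fun i g => w i (g * c^-1)%g)).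
  by move=> i g; rewrite mem_rtrans => /wU.
move=> y Ky; have [|i yi] := wP (act c y); first by exists y.
exists i => g; rewrite mem_rtrans => /yi; rewrite -actM mulgVK//.
Qed.

Definition refines U V : Prop := forall A, A \in U -> exists2 B, B \in V & A `<=` B.

Lemma ncov_refines U V E K : covers U -> refines U V ->
  (ncov V E K <= ncov U E K)%N.
Proof.
move=> UT UV; have [w wU wP] := ncov_names E K UT.
have /choice[f fP] : forall A, exists B, A \in U -> B \in V /\ A `<=` B.
  move=> A; case: (boolP (A \in U)) => [/UV[B BV AB]|_]; first by exists B.
  by exists A.
rewrite -[leqRHS]card_ord; apply: (@ncov_le _ (fun i g => f (w i g))).
  by move=> i g /(wU i)/fP[].
move=> y /wP[i yi]; exists i => g gE; have [_] := fP _ (wU i g gE).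
by apply; exact: yi.
Qed.

Lemma ncov_name_le1 U E K (w : G -> set X) : (forall g, g \in E -> w g \in U) ->
  K `<=` name_set E w -> (ncov U E K <= 1)%N.
Proof.
move=> wU Kw; rewrite -card_unit; apply: (@ncov_le _ (fun=> w)) => [_|y /Kw ?].
  exact: wU.
by exists tt.
Qed.

Lemma ncov_range (I : finType) (e : I -> X) U E K : covers U -> K `<=` range e ->
  (ncov U E K <= #|I|)%N.
Proof.
move=> UT Ke.
have /choice[f fP] : forall x, exists A, A \in U /\ A x.
  by move=> x; have [A AU Ay] := coversP UT x; exists A.
apply: (@ncov_le _ (fun i g => f (act g (e i)))) => [i g _|y /Ke[i _ <-]].
  by have [] := fP (act g (e i)).
by exists i => g _; have [] := fP (act g (e i)).
Qed.

Lemma ncov_set0 U E : ncov U E set0 = 0%N.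
Proof.
apply/eqP; rewrite -leqn0 -card_void.
by apply: (@ncov_le _ (fun _ _ => setT)) => // i; case: i.
Qed.

Lemma ncov_finite K : finite_set K ->
  exists k, forall U E, covers U -> (ncov U E K <= k)%N.
Proof.
move=> /finite_fsetP[D ->]; exists #|{: D}| => U E UT.
by apply: (@ncov_range _ val) => // x /= xD; exists [` xD]%fset.
Qed.

(** The version of separated sets for covers: distinct indices never share an itinerary, so [e] is
    injective as soon as [U] covers. *)
Definition separated U E (I : Type) (e : I -> X) : Prop :=
  forall i j w, (forall g, g \in E -> w g \in U) ->
    name_set E w (e i) -> name_set E w (e j) -> i = j.

Lemma ncov_separated (I : finType) (e : I -> X) U E : covers U ->
  separated U E e -> (#|I| <= ncov U E (range e))%N.
Proof.
move=> UT sep; have [w wU wP] := ncov_names E (range e) UT.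
have /choice[f fP] : forall i, exists j, name_set E (w j) (e i).
  by move=> i; apply: wP; exists i.
rewrite -[X in (_ <= X)%N]card_ord; apply: (@leq_card _ _ f) => i j fij.
by apply: sep (wU (f i)) (fP i) _; rewrite fij.
Qed.

Definition star_refines U V : Prop :=
  forall x, exists2 B, B \in V & forall A, A \in U -> A x -> A `<=` B.

(** If a separated family cannot be extended, every point of [K] shares an itinerary in [U] with one
    of its members. Replacing the sets met by the orbit of that member by their stars in [V] covers
    [K] with one itinerary per member, which is too few. *)
Lemma exists_separated U V E K (k : nat) : star_refines U V ->
  (k <= ncov V E K)%N -> exists2 e : 'I_k -> X, separated U E e & range e `<=` K.
Proof.
move=> UV; elim: k => [_|k IHk kV].
  exists (fun i : 'I_0 => False_rect X (notF (ltn_ord i))) => [i|y [i]];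
    by have := ltn_ord i.
have [e sep eK] := IHk (ltnW kV).
have [[y [Ky yP]]|no] := pselect (exists y, K y /\ forall i w,
    (forall g, g \in E -> w g \in U) -> name_set E w (e i) -> ~ name_set E w y).
  exists (fun i : 'I_k.+1 => if unlift ord0 i is Some j then e j else y).
    move=> i j w wU; case: (unliftP ord0 i) => [i' ->|->];
      case: (unliftP ord0 j) => [j' ->|->] //.
    - by move=> ei ej; congr (lift _ _); apply: sep wU ei ej.
    - by move=> ei /(yP _ _ wU ei).
    - by move=> ey ej; have := yP _ _ wU ej ey.
  by move=> _ [i _ <-]; case: unliftP => [j _|_//]; apply: eK; exists j.
exfalso.
suff : (ncov V E K <= k)%N by rewrite leqNgt kV.
rewrite -[leqRHS]card_ord.
have /choice[s' s'P] : forall x, exists B, B \in V /\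
    forall A, A \in U -> A x -> A `<=` B.
  by move=> x; have [B ? ?] := UV x; exists B.
apply: (@ncov_le _ (fun i g => s' (act g (e i)))) => [i g _|y Ky].
  by have [] := s'P (act g (e i)).
apply: contrapT => no'; apply: no; exists y; split => // i w wU ei ey.
apply: no'; exists i => g gE; have [_] := s'P (act g (e i)).
by move=> /(_ (w g) (wU g gE) (ei g gE)); apply; exact: ey.
Qed.

Lemma ncov_le_cond U V E w : (forall g, g \in E -> w g \in V) ->
  (ncov U E (name_set E w) <=
     cond_cover_num (dyn_join act U E) (dyn_join act V E))%N.
Proof.
move=> wV; have : name_set E w \in dyn_join act V E by apply/mem_dyn_join; exists w.
by move=> h; rewrite /cond_cover_num (big_rem _ h)/= leq_maxl.
Qed.

(** The chain rule: [K] is cut along its itineraries in [V], and each piece has at most the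
    conditional complexity. *)
Lemma ncov_le_mul_cond U V E K : covers U -> covers V ->
  (ncov U E K <= ncov V E K *
     cond_cover_num (dyn_join act U E) (dyn_join act V E))%N.
Proof.
move=> UT VT; have [w wV wP] := ncov_names E K VT.
apply: leq_trans (ncov_bigcup E UT wP) _.
apply: (@leq_trans (\sum_(i < ncov V E K)
    cond_cover_num (dyn_join act U E) (dyn_join act V E))%N).
  by apply: leq_sum => i _; exact: ncov_le_cond (wV i).
by rewrite sum_nat_const card_ord.
Qed.

Lemma ncov_le_exp U E K : covers U -> (ncov U E K <= #|` U| ^ #|` E|)%N.
Proof.
move=> UT; have [-> | /set0P[x0 _]] := eqVneq K set0; first by rewrite ncov_set0.
have -> : (#|` U| ^ #|` E|)%N = #|{ffun E -> U}| by rewrite card_ffun !cardfE.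
have [A0 A0U _] := coversP UT x0.
apply: (@ncov_le _ (fun (f : {ffun E -> U}) g =>
  if insub g is Some g' then val (f g') else A0)) => [f g gE|y _].
  by rewrite insubT/=; exact: valP.
have /choice[a aP] : forall x, exists A : U, (val A) x.
  by move=> x; have [A AU Ay] := coversP UT x; exists [` AU]%fset.
exists [ffun g => a (act (val g) y)] => g gE.
by rewrite insubT/= ffunE; exact: aP.
Qed.

End NameCounting.

(** * Quasi-tilings *)

Section Tilings.
Context {R : realType} {G : groupType}.
Implicit Types (S T C D E : {fset G}).

Definition tiles T C : {fset G} := [fset (t * c)%g | t in T, c in C]%fset.

Lemma mem_tiles T C (h : G) :
  reflect (exists2 c, c \in C & (h * c^-1)%g \in T) (h \in tiles T C).
Proof.
apply: (iffP (imfset2P _ _ _ _ _)) => [[t tT [c cC ->]]|[c cC hT]].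
  by exists c => //; rewrite mulgK.
by exists (h * c^-1)%g => //; exists c => //; rewrite mulgVK.
Qed.

Lemma rtrans_sub_tiles T C (c : G) : c \in C -> (rtrans T c `<=` tiles T C)%fset.
Proof. by move=> cC; apply/fsubsetP => h; rewrite mem_rtrans => hT; apply/mem_tiles; exists c. Qed.

Lemma tilesU1 T C (c : G) : tiles T (c |` C)%fset = (tiles T C `|` rtrans T c)%fset.
Proof.
apply/fsetP => h; rewrite in_fsetU mem_rtrans; apply/mem_tiles/orP.
  move=> [c']; rewrite !inE => /predU1P[->|c'C] hT; [by right|left].
  by apply/mem_tiles; exists c'.
move=> [/mem_tiles[c' c'C hT]|hT]; [exists c' => //|exists c => //].
  by rewrite !inE c'C orbT.
by rewrite !inE eqxx.
Qed.

Lemma leq_card_tiles T C : (#|` tiles T C| <= #|` T| * #|` C|)%N.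
Proof.
have H : {subset tiles T C <= [seq (t * c)%g | t <- enum_fset T, c <- enum_fset C]}.
  move=> h /imfset2P[t /= tT [c /= cC ->]]; apply/allpairsP.
  by exists (t, c).
by rewrite -(size_allpairs (fun t c : G => (t * c)%g)); apply: uniq_leq_size H; exact: fset_uniq.
Qed.

Lemma card_fsetI_count C D : #|` (C `&` D)%fset| = count (mem C) D.
Proof.
rewrite -size_filter; apply/perm_size/uniq_perm => [||x].
- exact: fset_uniq.
- exact/filter_uniq/fset_uniq.
- by rewrite mem_filter in_fsetI.
Qed.

(** Double counting: a point of [D] lies in [rtrans T c] for at most as many centres [c] as [T] has
    elements. *)
Lemma sum_card_rtransI T E D :
  (\sum_(c <- E) #|` (rtrans T c `&` D)%fset| <= #|` D| * #|` T|)%N.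
Proof.
under eq_bigr => c _ do rewrite card_fsetI_count -sum1_count big_mkcond/=.
rewrite exchange_big/=.
apply: (@leq_trans (\sum_(d <- D) #|` T|)%N); last first.
  by rewrite big_const_seq count_predT iter_addn_0 mulnC.
apply: leq_sum => d _; rewrite -big_mkcond/= sum1_count -size_filter.
rewrite -[X in (_ <= X)%N](size_map (fun t => t^-1 * d)%g).
apply: uniq_leq_size => [|c]; first exact/filter_uniq/fset_uniq.
rewrite mem_filter /= mem_rtrans => /andP[dT _]; apply/mapP.
by exists (d * c^-1)%g => //; rewrite invgM invgK mulgVK.
Qed.

(* The centres are added one at a time, keeping those whose translate of [T] is
   mostly new; a rejected centre meets the covered part in proportion [eps]. *)
Lemma greedy_tiles (eps : R) T E : eps <= 1 -> T != fset0 ->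
  exists C, [/\ (C `<=` E)%fset,
    (1 - eps) * (#|` C|%:R * #|` T|%:R) <= #|` tiles T C|%:R &
    eps * #|` E|%:R <= #|` tiles T C|%:R].
Proof.
move=> eps1 T0.
have [C [CE dC rej]] : exists C, [/\ {subset C <= enum_fset E},
    (1 - eps) * (#|` C|%:R * #|` T|%:R) <= #|` tiles T C|%:R &
    forall c, c \in enum_fset E ->
      eps * #|` T|%:R <= #|` (rtrans T c `&` tiles T C)%fset|%:R].
  elim: (enum_fset E) => [|c s [C [CE dC rej]]].
    exists fset0; split=> [x|//|//]; first by rewrite in_fset0.
    by rewrite cardfs0 mul0r mulr0 ler0n.
  have [ok|bad] := lerP (eps * #|` T|%:R) #|` (rtrans T c `&` tiles T C)%fset|%:R.
    exists C; split=> [x /CE|//|x]; first by rewrite in_cons orbC => ->.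
    by rewrite in_cons => /predU1P[->//|/rej].
  have cC : c \notin C.
    apply/negP => cC; move: bad; rewrite ltNge => /negP; apply.
    rewrite (fsetIidPl (rtrans_sub_tiles T cC)) card_rtrans.
    by rewrite -[leRHS]mul1r ler_wpM2r.
  exists (c |` C)%fset; split.
  - move=> x; rewrite !inE => /predU1P[->|/CE ->]; first by rewrite eqxx.
    by rewrite orbT.
  - rewrite tilesU1; have := cardfsUI (tiles T C) (rtrans T c).
    move=> /(congr1 (fun n : nat => n%:R : R)); rewrite !natrD card_rtrans cardfsU1 cC.
    rewrite fsetIC; move: bad dC; rewrite natrD/=; lra.
  - move=> x; rewrite in_cons tilesU1 => /predU1P[->|/rej le]; last first.
      apply: le_trans le _; rewrite ler_nat; apply: fsubset_leq_card.
      exact/fsetIS/fsubsetUl.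
    rewrite (fsetIidPl _) ?fsubsetUr// card_rtrans -[leRHS]mul1r ler_wpM2r//.
exists C; split=> //; first by apply/fsubsetP.
have T_gt0 : 0 < #|` T|%:R :> R by rewrite ltr0n cardfs_gt0.
(* Every centre of [E], kept or rejected, now has a translate covered in proportion [eps]; summing
   over [E] and double counting bounds the covered part from below. *)
rewrite -(ler_pM2r T_gt0) -mulrA [X in eps * X]mulrC mulrA -natrM.
apply: (@le_trans _ _ (\sum_(c <- E) #|` (rtrans T c `&` tiles T C)%fset|)%:R); last first.
  by rewrite ler_nat sum_card_rtransI.
rewrite natr_sum (@le_trans _ _ (\sum_(c <- E) eps * #|` T|%:R))//; last first.
  by rewrite big_seq [leRHS]big_seq; apply: ler_sum => c; exact: rej.
by rewrite big_const_seq count_predT iter_addr_0 mulr_natr.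
Qed.

Definition noninner T S : {fset G} := [fset c in S | ~~ (rtrans T c `<=` S)%fset]%fset.

Definition inner T S : {fset G} := [fset c in S | (rtrans T c `<=` S)%fset]%fset.

(** The outer boundary of [T]: the points [x] outside [T] for which [rtrans T' x] meets [T]. *)
Definition outer T' T : {fset G} :=
  ([fset (t^-1 * h)%g | t in T', h in T] `\` T)%fset.

Lemma card_inner T S : (#|` inner T S| + #|` noninner T S| = #|` S|)%N.
Proof.
rewrite -cardfsUI [X in (_ + #|` X|)%N](_ : _ = fset0) ?cardfs0 ?addn0.
  congr (#|` _|); apply/fsetP => c; rewrite !inE /=.
  by case: (c \in S) => //=; case: (_ `<=` _)%fset.
apply/fsetP => c; rewrite !inE /=.
by case: (c \in S) => //=; case: (_ `<=` _)%fset.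
Qed.

(** A centre spoiled by the removal of the tiles lies outside them, while its translate of [T']
    meets some [rtrans T c']; hence it belongs to the translate by [c'] of the outer boundary of
    [T]. *)
Lemma noninner_fsetD T' T C S :
  (#|` noninner T' (S `\` tiles T C)%fset| <=
     #|` noninner T' S| + #|` outer T' T| * #|` C|)%N.
Proof.
apply: leq_trans (leq_add (leqnn _) (leq_card_tiles _ _)).
apply: leq_trans (leq_card_fsetU _ _); apply: fsubset_leq_card.
apply/fsubsetP => c; rewrite !inE/= => /andP[/andP[cD cS]].
move=> /fsubsetPn[h]; rewrite mem_rtrans in_fsetD => hT'.
have [hS /=|hS _] := boolP (h \in S); last first.
  rewrite cS/=; apply/orP; left; apply/fsubsetPn; exists h => //.
  by rewrite mem_rtrans.
rewrite andbT negbK => /mem_tiles[c' c'C hc']; apply/orP; right.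
apply/mem_tiles; exists c' => //; rewrite !inE/=; apply/andP; split.
  by apply: contra cD => cc'; apply/mem_tiles; exists c'.
apply/imfset2P; exists (h * c^-1)%g => //; exists (h * c'^-1)%g => //.
by rewrite invgM invgK mulgA mulgVK.
Qed.

(** Both [outer] and [noninner] are contained in this union of symmetric differences, to which the
    Folner condition applies directly. *)
Definition boundary T S : {fset G} :=
  \big[fsetU/fset0]_(t <- T) symdiff S (ltranslate t^-1%g S).

Lemma mem_ltranslate (s : G) S (h : G) : (h \in ltranslate s S) = ((s^-1 * h)%g \in S).
Proof.
apply/imfsetP/idP => [[g /= gE ->]|hE]; first by rewrite mulKg.
by exists (s^-1 * h)%g => //; rewrite mulVKg.
Qed.

Lemma mem_boundary T S (t h : G) : t \in T ->
  h \in symdiff S (ltranslate t^-1%g S) -> h \in boundary T S.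
Proof. by move=> tT hS; apply/bigfcupP; exists t; rewrite ?tT. Qed.

Lemma outer_sub_boundary T' T : (outer T' T `<=` boundary T' T)%fset.
Proof.
apply/fsubsetP => x; rewrite in_fsetD => /andP[xT /imfset2P[t /= tT' [h /= hT xE]]].
apply: (mem_boundary tT'); rewrite !inE mem_ltranslate invgK xT /=.
by rewrite xE mulVKg hT orbT.
Qed.

Lemma noninner_sub_boundary T S : (noninner T S `<=` boundary T S)%fset.
Proof.
apply/fsubsetP => c; rewrite !inE/= => /andP[cS /fsubsetPn[h]].
rewrite mem_rtrans => hT hS; apply: (mem_boundary hT).
by rewrite !inE mem_ltranslate invgK mulgVK cS (negbTE hS).
Qed.

Lemma folner_boundary (F : nat -> {fset G}) T (d : R) : folner R F -> 0 < d ->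
  \forall n \near \oo, #|` boundary T (F n)|%:R <= d * #|` F n|%:R.
Proof.
move=> [F0 Finv] d0; rewrite /boundary.
elim: (enum_fset T) d d0 => [|t s IHs] d d0.
  by near=> n; rewrite big_nil cardfs0 mulr_ge0// ltW.
have d2 : 0 < d / 2 by rewrite divr_gt0.
have /cvgrPdist_le/(_ _ d2) := Finv t^-1%g; have {}IHs := IHs _ d2.
apply: filterS2 IHs => n IHn; rewrite sub0r normrN ger0_norm ?divr_ge0//.
have Fn0 : 0 < #|` F n|%:R :> R by rewrite ltr0n cardfs_gt0.
rewrite ler_pdivrMr// => sd; rewrite big_cons.
rewrite (@le_trans _ _ (#|` symdiff (F n) (ltranslate t^-1%g (F n))|%:R +
  #|` \big[fsetU/fset0]_(t <- s) symdiff (F n) (ltranslate t^-1%g (F n))|%:R))//.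
  by rewrite -natrD ler_nat leq_card_fsetU.
lra.
Unshelve. all: by end_near. Qed.

End Tilings.

(** An exponential Chebyshev bound: let each true value of [f] contribute a factor [expR (- s)] to
    its weight. All the weights add up to [(1 + expR (- s)) ^+ #|T|], and each function counted
    weighs at least [expR (- (s * a))]. *)
Lemma card_ffun_bool_small (R : realType) (T : finType) (a s : R) : 0 <= s ->
  #|[pred f : {ffun T -> bool} | #|[pred i | f i]|%:R <= a]|%:R
    <= expR (s * a + expR (- s) * #|T|%:R).
Proof.
move=> s0; rewrite expRD.
have key : \sum_(f : {ffun T -> bool}) expR (- s) ^+ #|[pred i | f i]| = (1 + expR (- s)) ^+ #|T|.
  transitivity (\prod_(i : T) \sum_(b : bool) (if b then expR (- s) else 1)); last first.
    under eq_bigr do rewrite big_bool/= addrC.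
    by rewrite prodr_const.
  rewrite bigA_distr_bigA; apply: eq_bigr => f _.
  by rewrite -big_mkcond/= prodr_const.
rewrite mulrC -ler_pdivrMr ?expR_gt0// -expRN.
apply: (@le_trans _ _ ((1 + expR (- s)) ^+ #|T|)); last first.
  rewrite expRM_natr; apply: lerXn2r; rewrite ?nnegrE ?addr_ge0 ?expR_ge0//.
  exact: expR_ge1Dx.
rewrite -key [leRHS](bigID (fun f : {ffun T -> bool} => #|[pred i | f i]|%:R <= a))/=.
apply: ler_wpDr; first by apply: sumr_ge0 => f _; rewrite exprn_ge0 ?expR_ge0.
rewrite -sum1_card natr_sum mulr_suml; apply: ler_sum => f /= fa.
rewrite mul1r -expRM_natr ler_expR -mulNr.
by rewrite !mulNr lerN2 ler_wpM2l.
Qed.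

Section QuasiTiling.
Context {R : realType} {G : groupType} {X : topologicalType} (act : G -> X -> X).
Context (actM : forall g h x, act (g * h)%g x = act g (act h x)).
Context (U V : {fset set X}) (UT : covers U).
Implicit Types (S T C D E : {fset G}) (Y : set X).

Local Notation ncov := (ncov act).
Local Notation name_set := (name_set act).

Lemma ncov_tiles (a : R) T C Y :
  (forall c, c \in C -> (ncov U (rtrans T c) Y)%:R <= expR a) ->
  (ncov U (tiles T C) Y)%:R <= expR (a * #|` C|%:R).
Proof.
elim/fset1U_rect: C => [_|c C cC IHC h].
  rewrite cardfs0 mulr0 expR0 lern1 (_ : tiles T fset0 = fset0).
    by apply: (@ncov_name_le1 _ _ _ _ _ _ (fun=> setT)) => // g; rewrite in_fset0.
  apply/fsetP => x; rewrite in_fset0; apply/negbTE/negP => /mem_tiles[c].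
  by rewrite in_fset0.
rewrite tilesU1 cardfsU1 cC natrD mulrDr mulr1 addrC expRD.
rewrite (@le_trans _ _ ((ncov U (tiles T C) Y)%:R * (ncov U (rtrans T c) Y)%:R))//.
  by rewrite -natrM ler_nat ncov_setU.
rewrite ler_pM//; last by apply: h; rewrite !inE eqxx.
by apply: IHC => c' c'C; apply: h; rewrite !inE c'C orbT.
Qed.

(* [Y] splits according to which type [b] prevails and to the centres [C] chosen
   by the greedy algorithm; there are few choices of [C] as the tiles are large. *)
Lemma tile_step (F : nat -> {fset G}) (eps lam eta s m Q : R) (M : nat)
    (n : bool -> nat) (Z : bool -> set X) S Y (w : G -> set X) :
  0 < eps -> eps < 1 -> 0 <= lam -> 0 <= s ->
  (forall b, (F (n b) `<=` F M)%fset) ->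
  (forall x, Z true x \/ Z false x) ->
  (forall b v, (forall g, g \in F M -> v g \in V) ->
    (ncov U (F (n b)) (name_set (F M) v `&` Z b))%:R
      <= expR (lam * #|` F (n b)|%:R)) ->
  (forall b, 1 <= (1 - eps) * eta * #|` F (n b)|%:R) ->
  #|` S|%:R <= m ->
  (forall g, g \in S -> w g \in V) ->
  Y `<=` name_set S w ->
  #|` noninner (F M) S|%:R <= #|` S|%:R / 2 :> R ->
  (forall b C Y', (C `<=` S)%fset -> Y' `<=` Y ->
     (tiles (F (n b)) C `<=` S)%fset ->
     (1 - eps) * (#|` C|%:R * #|` F (n b)|%:R) <= #|` tiles (F (n b)) C|%:R ->
     eps * (#|` S|%:R / 4) <= #|` tiles (F (n b)) C|%:R ->
     (ncov U (S `\` tiles (F (n b)) C)%fset Y')%:R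
       <= expR (Q - lam / (1 - eps) * #|` tiles (F (n b)) C|%:R)) ->
  (ncov U S Y)%:R <= 2 * expR (s * (eta * m) + expR (- s) * m) * expR Q.
Proof.
move=> eps0 eps1 lam0 s0 FM ZT hZ heta Sm wV YS nonin IH.
have e1 : 0 < 1 - eps by rewrite subr_gt0.
have Fn0 b : 0 < #|` F (n b)|%:R :> R.
  rewrite lt_neqAle ler0n andbT; apply/eqP => e0.
  by have := heta b; rewrite -e0 mulr0 ler10.
have eta0 : 0 < eta.
  have := heta true; rewrite -mulrA mulrCA => h.
  have : 0 < eta * ((1 - eps) * #|` F (n true)|%:R) by apply: lt_le_trans h.
  by rewrite pmulr_lgt0// mulr_gt0.
pose good b C y := [/\ (C `<=` inner (F M) S)%fset,
  forall c, c \in C -> Z b (act c y),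
  (1 - eps) * (#|` C|%:R * #|` F (n b)|%:R) <= #|` tiles (F (n b)) C|%:R &
  eps * (#|` S|%:R / 4) <= #|` tiles (F (n b)) C|%:R].
(* At least half of [S] consists of inner centres, so one of the two types is allowed at a quarter
   of [S]; the greedy tiles are centred there. *)
have goodP y : exists b C, good b C y.
  pose E b := [fset c in inner (F M) S | `[< Z b (act c y) >]]%fset.
  have [b Eb] : exists b, #|` S|%:R / 4 <= #|` E b|%:R :> R.
    apply: contrapT => no.
    have lt b : #|` E b|%:R < #|` S|%:R / 4 :> R.
      by rewrite ltNge; apply/negP => h; apply: no; exists b.
    have : (#|` inner (F M) S| <= #|` E true| + #|` E false|)%N.
      apply: leq_trans (leq_card_fsetU _ _); apply: fsubset_leq_card.
      apply/fsubsetP => c; rewrite !inE/= => ->/=; apply/orP.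
      by have [/asboolP|/asboolP] := ZT (act c y); [left|right].
    rewrite -(ler_nat R) natrD; move: (lt true) (lt false) nonin.
    have /(congr1 (fun k => k%:R : R)) := card_inner (F M) S; rewrite natrD.
    lra.
  have [||C [CE dC eC]] := @greedy_tiles R G eps (F (n b)) (E b); first exact: ltW.
    by rewrite -cardfs_gt0 -(ltr0n R).
  exists b, C; split => //.
  - apply: fsubset_trans CE _; apply/fsubsetP => c; by rewrite !inE/= => /andP[].
  - by move=> c /(fsubsetP CE); rewrite !inE/= => /andP[_ /asboolP].
  - by apply: le_trans eC; rewrite ler_pM2l.
(* Sets of centres are encoded by boolean functions on [S] with few true values, to be counted by
   [card_ffun_bool_small]. *)
pose Cf (f : {ffun S -> bool}) : {fset G} :=
  [fset c in S | if insub c is Some c' then f c' else false]%fset.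
pose J : finType := (bool * {f : {ffun S -> bool} | (#|[pred i | f i]|%:R <= eta * m)%R})%type.
pose Yj (j : J) := [set y | Y y /\ good j.1 (Cf (val j.2)) y].
have YJ y : Y y -> exists j, Yj j y.
  move=> Yy; have [b [C gC]] := goodP y; have [CI _ dC _] := gC.
  have CS : (C `<=` S)%fset.
    by apply: fsubset_trans CI _; apply/fsubsetP => c; rewrite !inE/= => /andP[].
  have DS : (tiles (F (n b)) C `<=` S)%fset.
    apply/fsubsetP => h /mem_tiles[c /(fsubsetP CI)]; rewrite !inE/= => /andP[_].
    move=> /fsubsetP cS hF; apply: cS; rewrite mem_rtrans.
    exact: (fsubsetP (FM b)).
  pose f := [ffun c : S => val c \in C].
  have CfE : Cf f = C.
    apply/fsetP => c; rewrite !inE/=; case: insubP => [c' _ <-|]/=.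
      by rewrite ffunE (fsvalP c').
    by move=> cS; rewrite (negbTE cS)/=; apply/esym/negbTE; apply: contra cS => /(fsubsetP CS).
  (* The almost disjoint tiles fit in [S] and are large by [heta], which limits their number. *)
  have fsmall : #|[pred i | f i]|%:R <= eta * m.
    apply: (@le_trans _ _ #|` C|%:R).
      rewrite ler_nat cardE -(size_map val); apply: uniq_leq_size.
        by rewrite map_inj_uniq ?enum_uniq//; exact: val_inj.
      by move=> _ /mapP[c + ->]; rewrite mem_enum inE ffunE.
    have Dm : #|` tiles (F (n b)) C|%:R <= m.
      by apply: le_trans Sm; rewrite ler_nat fsubset_leq_card.
    have := heta b; have := ler0n R #|` C|; move: dC Dm eta0 e1 (Fn0 b).
    set c := #|` C|%:R; set t := #|` F (n b)|%:R; set d := #|` tiles _ _|%:R.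
    move=> dC Dm eta0' e1' t0 c0 h.
    have h1 : c <= c * ((1 - eps) * eta * t) by rewrite -[leLHS]mulr1 ler_wpM2l.
    have h2 : eta * ((1 - eps) * (c * t)) <= eta * m.
      by rewrite ler_pM2l//; apply: le_trans Dm.
    apply: le_trans h2; apply: le_trans h1 _; rewrite le_eqVlt; apply/orP; left.
    by apply/eqP; ring.
  by exists (b, exist _ f fsmall); split=> //=; rewrite CfE.
have Jcard : #|J|%:R <= 2 * expR (s * (eta * m) + expR (- s) * m).
  rewrite card_prod card_bool card_sig natrM ler_pM2l//.
  apply: le_trans (card_ffun_bool_small _ _ s0) _.
  rewrite ler_expR lerD2l ler_wpM2l ?expR_ge0//.
  by rewrite -cardfE.
have Yjle j : (ncov U S (Yj j))%:R <= expR Q.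
  have [->|/set0P[y0 [Yy0 [CI0 _ dC eC]]]] := eqVneq (Yj j) set0.
    by rewrite ncov_set0 expR_ge0.
  move: j => [b [f /= fs]] in y0 Yy0 CI0 dC eC *.
  move: CI0 dC eC; set C := Cf f => CI dC eC.
  have CS : (C `<=` S)%fset.
    by apply: fsubset_trans CI _; apply/fsubsetP => c; rewrite !inE/= => /andP[].
  have DS : (tiles (F (n b)) C `<=` S)%fset.
    apply/fsubsetP => h /mem_tiles[c /(fsubsetP CI)]; rewrite !inE/= => /andP[_].
    move=> /fsubsetP cS hF; apply: cS; rewrite mem_rtrans.
    exact: (fsubsetP (FM b)).
  set Yb := Yj _; have YbY : Yb `<=` Y by move=> y [].
  (* Since [c] is an inner centre, the translate of [w] by [c] is followed from [act c y] throughout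
     [F M]; the hypothesis on name sets thus applies to each tile. *)
  have bD : (ncov U (tiles (F (n b)) C) Yb)%:R
      <= expR (lam * #|` F (n b)|%:R * #|` C|%:R).
    apply: ncov_tiles => c cC; have := fsubsetP CI _ cC.
    rewrite !inE/= => /andP[_ /fsubsetP FMc].
    have FcS g : g \in F M -> (g * c)%g \in S.
      by move=> gM; apply: FMc; rewrite mem_rtrans mulgK.
    apply: le_trans (hZ b (fun g => w (g * c)%g) _) => [|g /FcS/wV//].
    rewrite ler_nat; apply: leq_trans (ncov_rtrans _ _ _ UT actM) _.
    apply: ncov_sub => // _ [y [Yy [_ Zy _ _]] <-]; split; last exact: Zy.
    by move=> g /FcS gS /=; rewrite -actM; exact: YS.
  have := IH b C Yb CS YbY DS dC eC; set D := tiles _ _ in dC DS bD *.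
  move=> bR.
  have SE : (D `|` (S `\` D))%fset = S.
    apply/fsetP => x; rewrite !inE; case: (boolP (x \in D)) => //= xD.
    by rewrite (fsubsetP DS).
  rewrite (@le_trans _ _ ((ncov U D Yb)%:R * (ncov U (S `\` D)%fset Yb)%:R))//.
    by rewrite -natrM ler_nat; have := ncov_setU act D (S `\` D)%fset Yb UT; rewrite SE.
  apply: le_trans (ler_pM _ _ bD bR) _ => //; rewrite -expRD ler_expR.
  (* Almost disjointness turns the rate [lam] on each tile into the rate [lam / (1 - eps)] on the
     union of the tiles. *)
  have : lam / (1 - eps) * ((1 - eps) * (#|` C|%:R * #|` F (n b)|%:R)) <=
         lam / (1 - eps) * #|` D|%:R.
    by rewrite ler_wpM2l// divr_ge0// ltW.
  rewrite (mulrA (lam / (1 - eps)) (1 - eps)) divfK ?gt_eqF//; lra.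
apply: (@le_trans _ _ (\sum_(j : J) ncov U S (Yj j))%:R).
  by rewrite ler_nat ncov_bigcup.
rewrite natr_sum (@le_trans _ _ (\sum_(j : J) expR Q))//; first exact: ler_sum.
rewrite sumr_const -[leLHS]mulr_natl; apply: ler_wpM2r; [exact: expR_ge0|exact: Jcard].
Qed.

End QuasiTiling.

(** * Tiling bounds for conditional complexity *)

Section TilingBound.
Context {R : realType} {G : groupType} {X : topologicalType} (act : G -> X -> X).
Context (actM : forall g h x, act (g * h)%g x = act g (act h x)).
Context (F : nat -> {fset G}).
Context (F_folner : folner R F).
Context (F_homo : forall m n, (m <= n)%N -> (F m `<=` F n)%fset).
Context (F_large : forall B : R, \forall n \near \oo, B <= #|` F n|%:R).
Context (U V : {fset set X}) (UT : covers U).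
Implicit Types (S T C D E : {fset G}) (Y : set X).

Local Notation ncov := (ncov act).
Local Notation name_set := (name_set act).

Lemma cond_cover_num_le E (x : R) : 0 <= x ->
  (forall w, (forall g, g \in E -> w g \in V) ->
     (ncov U E (name_set E w))%:R <= x) ->
  (cond_cover_num (dyn_join act U E) (dyn_join act V E))%:R <= x.
Proof.
move=> x0 h; rewrite /cond_cover_num big_seq.
elim/big_ind: _ => // [a b ax bx|A /mem_dyn_join[w wV ->]]; last exact: h.
by rewrite /maxn; case: ifP.
Qed.

(* With [n] constant and [Z true = setT] this is the hypothesis of the Ornstein-Weiss
   lemma; the second part of [X] allows to neglect small neighbourhoods of finitely
   many points, which call for tiles of another size. *)
Definition tileable (lam : R) : Prop :=
  forall N : nat, exists (n : bool -> nat) (M : nat) (Z : bool -> set X),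
    [/\ forall b, (N <= n b <= M)%N,
        forall x, Z true x \/ Z false x &
        forall b v, (forall g, g \in F M -> v g \in V) ->
          (ncov U (F (n b)) (name_set (F M) v `&` Z b))%:R
            <= expR (lam * #|` F (n b)|%:R)].

(** Here [m] is the size of an initial set and [S] is what remains of it. While [S] exceeds
    [eps * m], a round of tiling removes at least [eps ^+ 2 / 4 * m] points, and its choice of
    centres costs [theta * m] in the exponent. Once [S] is smaller, it is bounded trivially through
    [C0]. *)
Lemma tiling_induction (lam eps theta C0 : R) (k : nat) :
  0 <= lam -> 0 < eps -> eps < 1 -> 0 < theta -> 0 <= C0 ->
  (forall S Y, (ncov U S Y)%:R <= expR (C0 * #|` S|%:R)) ->
  tileable lam ->
  exists2 d : R, 0 < d & exists M : nat, forall S Y w (m : R),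
    ln 2 <= theta / 3 * m -> #|` S|%:R <= m ->
    #|` S|%:R <= (eps + k%:R * (eps ^+ 2 / 4)) * m ->
    (forall g, g \in S -> w g \in V) -> Y `<=` name_set S w ->
    #|` noninner (F M) S|%:R <= d * m ->
    (ncov U S Y)%:R
      <= expR (lam / (1 - eps) * #|` S|%:R + k%:R * theta * m + C0 * eps * m).
Proof.
move=> lam0 eps0 eps1 theta0 C00 hC0 tlam.
have e1 : 0 < 1 - eps by rewrite subr_gt0.
have lame : 0 <= lam / (1 - eps) by rewrite divr_ge0// ltW.
elim: k => [|k [d d0 [M0 IH]]].
  exists 1 => //; exists 0%N => S Y w m _ Sm; rewrite mul0r addr0 => Sem _ _ _.
  apply: le_trans (hC0 _ _) _; rewrite ler_expR !mul0r addr0 -(mulrA C0).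
  by apply: ler_wpDl; [exact: mulr_ge0|exact: ler_wpM2l].
(* The cost [theta * m] of a round is split in three: one third each for [s * eta], for [expR (- s)]
   and for the factor 2 due to the types. *)
pose s := Num.max 0 (- ln (theta / 3)); pose eta := theta / (3 * (s + 1)).
have s0 : 0 <= s by rewrite le_max lexx.
have s1 : 0 < s + 1 by lra.
have t3 : 0 < theta / 3 by rewrite divr_gt0.
have es : expR (- s) <= theta / 3.
  rewrite -[leRHS]lnK ?posrE// ler_expR lerNl le_max lexx orbT//.
have eta0 : 0 < eta by rewrite divr_gt0// mulr_gt0.
have seta : s * eta <= theta / 3.
  have -> : theta / 3 = (s + 1) * eta by rewrite /eta; field; lra.
  by apply: ler_wpM2r; [exact: ltW|rewrite lerDl].
have d2 : 0 < d / 2 * (1 - eps) by rewrite mulr_gt0// divr_gt0.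
have [N1 _ hN1] := folner_boundary (F M0) F_folner d2.
have [N2 _ hN2] := F_large ((1 - eps) * eta)^-1.
(* Beyond [M0], which governs the later rounds, [N1] makes the outer boundary of the new tiles small
   and [N2] makes these tiles large enough for [heta]. *)
have [n [M [Z [nM ZT hZ]]]] := tlam (maxn M0 (maxn N1 N2)).
have nN1 b : (N1 <= n b)%N.
  by have /andP[+ _] := nM b; apply: leq_trans; rewrite leq_max leq_maxl orbT.
have nN2 b : (N2 <= n b)%N.
  by have /andP[+ _] := nM b; apply: leq_trans; rewrite leq_max leq_maxr orbT.
have M0M : (M0 <= M)%N.
  apply: leq_trans (leq_maxl M0 (maxn N1 N2)) _.
  by have /andP[h1 h2] := nM true; exact: leq_trans h1 h2.
(* The bound [eps / 2] keeps half of [S] inner while [S] exceeds [eps * m]; the bound [d / 2] leaves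
   the other half of [d] to the centres spoiled by the tiles. *)
exists (Num.min (eps / 2) (d / 2)); first by rewrite lt_min !divr_gt0.
exists M => S Y w m m2 Sm Sk wV YS nonin.
have m0 : 0 <= m by apply: le_trans Sm.
have [Se|Se] := lerP #|` S|%:R (eps * m).
  apply: le_trans (hC0 _ _) _; rewrite ler_expR -(mulrA C0).
  have : 0 <= lam / (1 - eps) * #|` S|%:R by rewrite mulr_ge0.
  have : 0 <= k.+1%:R * theta * m by rewrite !mulr_ge0// ltW.
  have : C0 * #|` S|%:R <= C0 * (eps * m) by rewrite ler_wpM2l.
  lra.
have noninS : #|` noninner (F M) S|%:R <= #|` S|%:R / 2 :> R.
  apply: le_trans nonin _; rewrite (@le_trans _ _ (eps / 2 * m))//; last lra.
  by rewrite ler_wpM2r// ge_min lexx.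
have FM b : (F (n b) `<=` F M)%fset by apply: F_homo; case/andP: (nM b).
have heta b : 1 <= (1 - eps) * eta * #|` F (n b)|%:R.
  have h0 : 0 < (1 - eps) * eta by exact: mulr_gt0.
  by rewrite -(ler_pdivrMl _ _ h0) mulr1; exact: hN2 (nN2 b).
have := tile_step actM UT eps0 eps1 lam0 s0 FM ZT hZ heta Sm wV YS noninS
  (Q := lam / (1 - eps) * #|` S|%:R + k%:R * theta * m + C0 * eps * m).
move=> /(_ _)/le_trans; apply.
  move=> b C Y' CS Y'Y DS dC eC; set D := tiles _ _ in DS dC eC *.
  have cSD : #|` (S `\` D)%fset|%:R = #|` S|%:R - #|` D|%:R :> R.
    by rewrite cardfsDS// natrB// fsubset_leq_card.
  have -> : lam / (1 - eps) * #|` S|%:R + k%:R * theta * m + C0 * eps * m -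
      lam / (1 - eps) * #|` D|%:R =
      lam / (1 - eps) * #|` (S `\` D)%fset|%:R + k%:R * theta * m + C0 * eps * m.
    by rewrite cSD; ring.
  have Dm : #|` D|%:R <= m by apply: le_trans Sm; rewrite ler_nat fsubset_leq_card.
  apply: (IH _ _ w) => //.
  - by rewrite cSD; have := ler0n R #|` D|; lra.
  - rewrite cSD; have : eps * (eps * m) <= eps * #|` S|%:R by rewrite ler_pM2l// ltW.
    move: Sk eC; rewrite -[in k.+1%:R]addn1 natrD expr2; lra.
  - by move=> g; rewrite in_fsetD => /andP[_ /wV].
  - by move=> y /Y'Y/YS yw g; rewrite in_fsetD => /andP[_ /yw].
  have := noninner_fsetD (F M0) (F (n b)) C S.
  rewrite -(ler_nat R) natrD natrM => /le_trans; apply.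
  have h1 : #|` noninner (F M0) S|%:R <= d / 2 * m.
    apply: (@le_trans _ _ #|` noninner (F M) S|%:R).
      rewrite ler_nat fsubset_leq_card//; apply/fsubsetP => c.
      rewrite !inE/= => /andP[-> /=]; apply: contra => /fsubsetP h.
      apply/fsubsetP => x; rewrite mem_rtrans => /(fsubsetP (F_homo M0M)) xM.
      by apply: h; rewrite mem_rtrans.
    by apply: le_trans nonin _; rewrite ler_wpM2r// ge_min lexx orbT.
  have h2 : #|` outer (F M0) (F (n b))|%:R <= d / 2 * (1 - eps) * #|` F (n b)|%:R :> R.
    apply: le_trans (hN1 _ (nN1 b)).
    by rewrite ler_nat fsubset_leq_card// outer_sub_boundary.
  have h3 : #|` outer (F M0) (F (n b))|%:R * #|` C|%:R <=
      d / 2 * (1 - eps) * #|` F (n b)|%:R * #|` C|%:R :> R by rewrite ler_wpM2r.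
  have h4 : d / 2 * ((1 - eps) * (#|` C|%:R * #|` F (n b)|%:R)) <= d / 2 * #|` D|%:R.
    by rewrite ler_wpM2l//; lra.
  have h5 : d / 2 * #|` D|%:R <= d / 2 * m by rewrite ler_wpM2l//; lra.
  lra.
rewrite -[X in X * _ * _](@lnK _ (2 : R)) ?posrE// -!expRD ler_expR.
have : s * eta * m <= theta / 3 * m by rewrite ler_wpM2r.
have : expR (- s) * m <= theta / 3 * m by rewrite ler_wpM2r.
rewrite -[in k.+1%:R]addn1 natrD; lra.
Qed.

(** A large Folner set has few non-inner centres, so it can enter [tiling_induction] with enough
    rounds to be exhausted. *)
Lemma tileable_cond_cover_num (lam lam' : R) : 0 <= lam -> lam < lam' ->
  tileable lam ->
  \forall p \near \oo,
    (cond_cover_num (dyn_join act U (F p)) (dyn_join act V (F p)))%:R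
      <= expR (lam' * #|` F p|%:R).
Proof.
move=> lam0 lamlam' tlam.
pose C0 : R := ln #|` U|%:R.
have C00 : 0 <= C0.
  rewrite /C0; case: #|` U| => [|u]; first by rewrite ln0.
  by rewrite ln_ge0// ler1n.
have hC0 S Y : (ncov U S Y)%:R <= expR (C0 * #|` S|%:R).
  have [->|/set0P Y0] := eqVneq Y set0.
    by rewrite ncov_set0 expR_ge0.
  have U0 : 0 < #|` U|%:R :> R.
    have [y _] := Y0; have [A AU _] := coversP UT y.
    by rewrite ltr0n cardfs_gt0; apply/fset0Pn; exists A.
  by rewrite expRM_natr lnK ?posrE// -natrX ler_nat; exact: ncov_le_exp.
pose gap := lam' - lam; have gap0 : 0 < gap by rewrite subr_gt0.
have L0 : 0 < 2 * (2 * lam + C0 + 1) by lra.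
(* From [eps <= 1 / 2] follows [lam / (1 - eps) <= lam + 2 * lam * eps]. The errors proportional to
   [eps] then take at most half of the gap, and the [k] rounds at cost [theta] take the other
   half. *)
pose eps := Num.min (1 / 2) (gap / (2 * (2 * lam + C0 + 1))).
have eps0 : 0 < eps by rewrite lt_min !divr_gt0.
have eps12 : eps <= 1 / 2 by rewrite ge_min lexx.
have eps1 : eps < 1 by lra.
have epsL : eps * (2 * (2 * lam + C0 + 1)) <= gap.
  by rewrite -ler_pdivlMr// ge_min lexx orbT.
pose k := (Num.truncn (4 / eps ^+ 2)).+1.
have hk : 1 <= k%:R * (eps ^+ 2 / 4).
  have : 4 / eps ^+ 2 < k%:R.
    by rewrite /k truncnS_gt.
  rewrite ltr_pdivrMr ?exprn_gt0// => h; lra.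
pose theta := gap / (2 * k%:R).
have k0 : 0 < k%:R :> R by rewrite ltr0n.
have theta0 : 0 < theta by rewrite divr_gt0// mulr_gt0.
have ktheta : k%:R * theta = gap / 2 by rewrite /theta; field; rewrite gt_eqF.
have [d d0 [M hM]] := tiling_induction k lam0 eps0 eps1 theta0 C00 hC0 tlam.
have t3 : 0 < theta / 3 by rewrite divr_gt0.
apply: filterS2 (F_large (ln 2 / (theta / 3))) (folner_boundary (F M) F_folner d0).
move=> p /=; rewrite (ler_pdivrMr _ _ t3) [_ * (theta / 3)]mulrC => p1 p2.
apply: cond_cover_num_le => [|w wV]; first exact: expR_ge0.
have Fp0 : 0 <= #|` F p|%:R :> R by [].
apply: le_trans (hM _ _ _ _ p1 (lexx _) _ wV (fun y h => h) _) _.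
- by rewrite -[leLHS]mul1r ler_wpM2r//; lra.
- apply: le_trans p2; rewrite ler_nat fsubset_leq_card//.
  exact: noninner_sub_boundary.
rewrite ler_expR -!mulrDl ler_wpM2r// ktheta.
have : lam / (1 - eps) <= lam + 2 * lam * eps.
  rewrite ler_pdivrMr; last by lra.
  have : 0 <= lam * eps * (1 - 2 * eps) by rewrite !mulr_ge0//; lra.
  lra.
rewrite /gap in epsL *; lra.
Qed.

End TilingBound.

(** * Entropy as exponential growth of complexity *)

(** A bound met infinitely often is almost met eventually; so the infimum of such bounds, which is
    the lower limit, is the upper limit as well. *)
Lemma cvg_frequently_le (R : realType) (u : R^nat) (B : R) :
  (forall n, 0 <= u n <= B) ->
  (forall a b, 0 <= a -> a < b -> (forall N, exists2 n, (N <= n)%N & u n <= a) ->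
    \forall n \near \oo, u n <= b) ->
  exists l : R, u @ \oo --> l.
Proof.
move=> uB hu; pose S := [set a : R | 0 <= a /\ forall N, exists2 n, (N <= n)%N & u n <= a].
have SB : S B.
  by split=> [|N]; [have /andP[/le_trans] := uB 0%N; apply; have /andP[] := uB 0%N
                   |exists N => //; have /andP[] := uB N].
have S0 : lbound S 0 by move=> a [].
have hS : has_inf S by split; [exists B|exists 0].
exists (inf S); apply/cvgrPdist_le => e e0.
have [a Sa ale] := inf_adherent (divr_gt0 e0 (ltr0Sn R 1)) hS.
have upper : \forall n \near \oo, u n <= inf S + e.
  by apply: (hu a) => //; case: Sa => //; lra.
have lower : \forall n \near \oo, inf S - e <= u n.
  apply: contrapT => no.
  have fr N : exists2 n, (N <= n)%N & u n <= inf S - e.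
    apply: contrapT => noN; apply: no; exists N => // n /= Nn.
    by rewrite leNgt; apply/negP => /ltW h; apply: noN; exists n.
  have : S (inf S - e).
    split=> //; have [n _ h] := fr 0%N; apply: le_trans h.
    by have /andP[] := uB n.
  by move=> /(ge_inf (ex_intro _ 0 S0)); lra.
by apply: filterS2 upper lower => n h1 h2; rewrite ler_norml; lra.
Qed.

Lemma limn_esup_lt_near (R : realType) (u : (\bar R)^nat) (l : \bar R) :
  (limn_esup u < l)%E -> \forall n \near \oo, (u n < l)%E.
Proof.
rewrite /limn_esup limf_esupE => /ereal_inf_lt[_ [A nA <-]] h.
apply: filterS nA => n An; apply: le_lt_trans h.
by apply: ereal_sup_ubound; exists n.
Qed.

Lemma limn_esup_le_near (R : realType) (u : (\bar R)^nat) (l : \bar R) :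
  (\forall n \near \oo, (u n <= l)%E) -> (limn_esup u <= l)%E.
Proof.
move=> nul; rewrite /limn_esup limf_esupE; apply: ereal_inf_le => //.
exists (ereal_sup (u @` [set n | (u n <= l)%E])); first by exists [set n | (u n <= l)%E].
by apply: ge_ereal_sup => _ [n ? <-].
Qed.

Section EntropyBounds.
Context {R : realType} {G : groupType} {X : topologicalType} (act : G -> X -> X).
Context (actM : forall g h x, act (g * h)%g x = act g (act h x)).
Context (F : nat -> {fset G}).
Context (F_folner : folner R F).
Context (F_homo : forall m n, (m <= n)%N -> (F m `<=` F n)%fset).
Context (F_large : forall B : R, \forall n \near \oo, B <= #|` F n|%:R).
Implicit Types (U V : {fset set X}) (K Y : set X) (h : R).

Local Notation ncov := (ncov act).
Local Notation htop := (@htop R G X act F).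
Local Notation htop_cond := (@htop_cond R G X act F).
Local Notation ncond U V n := (cond_cover_num (dyn_join act U (F n)) (dyn_join act V (F n))).

Lemma card_folner_gt0 n : 0 < #|` F n|%:R :> R.
Proof. by rewrite ltr0n cardfs_gt0; case: F_folner. Qed.
Local Hint Resolve card_folner_gt0 : core.

(** For [c = 0] both sides hold, as [ln 0 = 0] and [h] is nonnegative. *)
Lemma log_card_le (c n : nat) h : 0 <= h ->
  ((#|` F n|%:R)^-1 * ln c%:R <= h) = (c%:R <= expR (h * #|` F n|%:R)).
Proof.
move=> h0; rewrite ler_pdivrMl// mulrC; case: c => [|c].
  by rewrite ln0// expR_ge0 mulr_ge0.
by rewrite -ler_expR lnK// posrE.
Qed.

Lemma htop_le K h : 0 <= h ->
  (forall U, open_cover U -> forall h', h < h' ->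
     \forall n \near \oo, (ncov U (F n) K)%:R <= expR (h' * #|` F n|%:R)) ->
  (htop K <= h%:E)%E.
Proof.
move=> h0 hU; apply: ge_ereal_sup => _ [U Uc <-].
apply/lee_addgt0Pr => e e0; apply: limn_esup_le_near.
have he : h < h + e by rewrite ltrDl.
apply: filterS (hU U Uc _ he) => n hn; rewrite -EFinD lee_fin log_card_le//.
exact: le_trans (ltW he).
Qed.

Lemma htop_lt K h : (htop K < h%:E)%E -> forall U, open_cover U ->
  \forall n \near \oo, (ncov U (F n) K)%:R <= expR (h * #|` F n|%:R).
Proof.
move=> hK U Uc; have /limn_esup_lt_near : (limn_esup (fun n =>
    ((#|` F n|%:R)^-1 * ln (ncov U (F n) K)%:R)%:E) < h%:E)%E.
  by apply: le_lt_trans hK; apply: ereal_sup_ubound; exists U.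
apply: filterS => n; rewrite lte_fin => /ltW hn.
rewrite -log_card_le//; apply: le_trans hn; apply: mulr_ge0; first by rewrite invr_ge0 ltW.
by case: (ncov U _ K) => [|c]; [rewrite ln0|rewrite ln_ge0// ler1n].
Qed.

Lemma htop_ge0 K : (0 <= htop K)%E.
Proof.
have Uc : open_cover ([fset setT]%fset : {fset set X}).
  split=> [A|]; first by rewrite inE => /eqP ->; exact: openT.
  by apply/seteqP; split=> // x _; exists setT => //=; rewrite inE.
apply: le_trans (ereal_sup_ubound (ex_intro2 _ _ _ Uc erefl)).
apply: limf_esup_ge0; first by move=> [N _ /(_ N)]; apply => /=.
move=> n; rewrite lee_fin; apply: mulr_ge0; first by rewrite invr_ge0 ltW.
by case: cover_num => [|c]; [rewrite ln0|rewrite ln_ge0// ler1n].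
Qed.

Lemma htop_ge K h :
  (forall h', h' < h -> exists2 U, open_cover U & forall N, exists2 n, (N <= n)%N &
     expR (h' * #|` F n|%:R) <= (ncov U (F n) K)%:R) ->
  (h%:E <= htop K)%E.
Proof.
move=> hh; rewrite leNgt; apply/negP => hK.
have htop_fin : htop K = (fine (htop K))%:E.
  rewrite fineK// ge0_fin_numE ?htop_ge0//.
  exact: lt_trans hK (ltry h).
move: hK; rewrite htop_fin lte_fin => hK.
pose d := (h - fine (htop K)) / 3; have d0 : 0 < d by rewrite divr_gt0// subr_gt0.
have [|U Uc hU] := hh (h - d); first by lra.
have [N _ hN] : \forall n \near \oo,
    (ncov U (F n) K)%:R <= expR ((fine (htop K) + d) * #|` F n|%:R).
  by apply: htop_lt => //; rewrite htop_fin lte_fin; lra.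
have [n Nn hn] := hU N; have := le_trans hn (hN _ Nn).
by rewrite ler_expR ler_pM2r// /d; lra.
Qed.

Lemma htop_sub K Y : K `<=` Y -> (htop K <= htop Y)%E.
Proof.
move=> KY; rewrite leNgt; apply/negP => YK.
have fY : htop Y = (fine (htop Y))%:E.
  by rewrite fineK// ge0_fin_numE ?htop_ge0// (lt_le_trans YK)// leey.
have : (htop K <= (fine (htop Y))%:E)%E.
  apply: htop_le => [|U Uc h hh]; first by rewrite fine_ge0// htop_ge0.
  have : \forall n \near \oo, (ncov U (F n) Y)%:R <= expR (h * #|` F n|%:R).
    by apply: htop_lt => //; rewrite fY lte_fin.
  apply: filterS => n; apply: le_trans; rewrite ler_nat ncov_sub//.
  exact: open_cover_covers.
by rewrite leNgt -fY YK.
Qed.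

Lemma near_mul_expR (B a b : R) : a < b ->
  \forall n \near \oo, B * expR (a * #|` F n|%:R) <= expR (b * #|` F n|%:R).
Proof.
move=> ab; have [B0|B0] := lerP B 0.
  by apply: nearW => n; rewrite (@le_trans _ _ 0)// ?expR_ge0// mulr_le0_ge0 ?expR_ge0.
have ab0 : 0 < b - a by rewrite subr_gt0.
apply: filterS (F_large (ln B / (b - a))) => n.
rewrite ler_pdivrMr// => hn.
rewrite -[X in X * _](@lnK _ B) ?posrE// -expRD ler_expR; lra.
Qed.

(** Two thirds of the gap absorb the two factors [n.+1%:R], and the last third absorbs the
    constant. *)
Lemma near_mul_sqr_expR (B a b : R) : a < b ->
  (forall e : R, 0 < e -> \forall n \near \oo, n.+1%:R <= expR (e * #|` F n|%:R)) ->
  \forall n \near \oo,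
    B * n.+1%:R ^+ 2 * expR (a * #|` F n|%:R) <= expR (b * #|` F n|%:R).
Proof.
move=> ab Fgr; pose d := (b - a) / 3.
have d0 : 0 < d by rewrite divr_gt0// subr_gt0.
have ad : a + d + d < b by rewrite /d; lra.
apply: filterS2 (Fgr _ d0) (near_mul_expR `|B| ad) => n h1.
apply: le_trans; apply: (@le_trans _ _ (`|B| * n.+1%:R ^+ 2 * expR (a * #|` F n|%:R))).
  by rewrite ler_wpM2r ?expR_ge0// ler_wpM2r ?exprn_ge0// ler_norm.
rewrite -mulrA ler_wpM2l// !mulrDl !expRD mulrC -mulrA ler_wpM2l ?expR_ge0// expr2.
by rewrite ler_pM.
Qed.

Lemma htop_cond_cvg U V : open_cover U ->
  exists2 l : R, htop_cond U V = l%:E &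
    (fun n => (#|` F n|%:R)^-1 * ln (ncond U V n)%:R : R) @ \oo --> l.
Proof.
move=> Uc; have UT := open_cover_covers Uc.
set u := fun n : nat => _.
have u0 n : 0 <= u n.
  rewrite /u mulr_ge0 ?invr_ge0//.
  by case: cond_cover_num => [|c]; [rewrite ln0|rewrite ln_ge0// ler1n].
have uB n : 0 <= u n <= ln (#|` U|.+1)%:R.
  rewrite u0/= /u log_card_le ?ln_ge0 ?ler1n//; apply: cond_cover_num_le; first exact: expR_ge0.
  move=> w _; rewrite expRM_natr lnK ?posrE// -natrX ler_nat.
  by apply: leq_trans (ncov_le_exp _ _ _ UT) _; rewrite leq_exp2r// cardfs_gt0; case: F_folner.
have [|l ul] := cvg_frequently_le uB.
  move=> a b a0 ab fr.
  have b0 : 0 <= b by rewrite (le_trans a0)// ltW.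
  (* Tiles of a single size: both types have size [n] and are allowed everywhere. *)
  have : tileable act F U V a.
    move=> N; have [n Nn] := fr N; rewrite /u log_card_le// => hn.
    exists (fun=> n), n, (fun=> setT); split=> [b'|x|b' v vV].
    - by rewrite Nn leqnn.
    - by left.
    - rewrite setIT; apply: le_trans hn; rewrite ler_nat.
      exact: ncov_le_cond.
  move=> /(tileable_cond_cover_num actM F_folner F_homo F_large UT a0 ab).
  by apply: filterS => n; rewrite /u log_card_le.
exists l => //; apply/cvg_lim => //.
by apply/fine_cvgP; split; [exact: nearW|].
Qed.

Lemma htop_cond_lt U V (t : R) : open_cover U -> (htop_cond U V < t%:E)%E ->
  \forall n \near \oo, (ncond U V n)%:R <= expR (t * #|` F n|%:R).
Proof.
move=> Uc; have [l -> ul] := htop_cond_cvg V Uc; rewrite lte_fin => lt.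
have l0 : 0 <= l.
  apply: (cvgr_to_ge ul); apply: nearW => n; apply: mulr_ge0; first by rewrite invr_ge0 ltW.
  by case: cond_cover_num => [|c]; [rewrite ln0|rewrite ln_ge0// ler1n].
have hl : \forall n \near \oo, (#|` F n|%:R)^-1 * ln (ncond U V n)%:R <= t.
  exact: (cvgr_le _ ul).
apply: filterS hl => n; rewrite log_card_le//.
exact: le_trans (ltW lt).
Qed.

Lemma htop_cond_le U V (t : R) : open_cover U -> 0 <= t ->
  (\forall n \near \oo, (ncond U V n)%:R <= expR (t * #|` F n|%:R)) ->
  (htop_cond U V <= t%:E)%E.
Proof.
move=> Uc t0 ht; have [l -> ul] := htop_cond_cvg V Uc; rewrite lee_fin.
apply: (cvgr_to_le ul); apply: filterS ht => n; by rewrite log_card_le.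
Qed.

Lemma htop_cond_ge0 U V : open_cover U -> (0 <= htop_cond U V)%E.
Proof.
move=> Uc; rewrite leNgt; apply/negP => neg.
have [l lE ul] := htop_cond_cvg V Uc; move: neg; rewrite lE lte_fin ltNge => /negP; apply.
apply: (cvgr_to_ge ul); apply: nearW => n; apply: mulr_ge0; first by rewrite invr_ge0 ltW.
by case: cond_cover_num => [|c]; [rewrite ln0|rewrite ln_ge0// ler1n].
Qed.

Lemma asymptotically_h_expansiveP : asymptotically_h_expansive R act F <->
  forall t : R, 0 < t -> exists2 V, open_cover V &
    forall U, open_cover U ->
      \forall n \near \oo, (ncond U V n)%:R <= expR (t * #|` F n|%:R).
Proof.
rewrite /asymptotically_h_expansive /tail_entropy; split=> [tail0 t t0|tailt].
  have /ereal_inf_lt[_ [V Vc <-] hV] : (ereal_inf [set ereal_sup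
      [set htop_cond U V | U in @open_cover X] | V in @open_cover X] < t%:E)%E.
    by rewrite tail0 lte_fin.
  exists V => // U Uc; apply: htop_cond_lt => //.
  by apply: le_lt_trans hV; apply: ereal_sup_ubound; exists U.
apply/eqP; rewrite eq_le; apply/andP; split.
  apply/lee_addgt0Pr => e e0; rewrite add0e; have [V Vc hV] := tailt e e0.
  apply: (@le_trans _ _ (ereal_sup [set htop_cond U V | U in @open_cover X])).
    by apply: ereal_inf_lbound; exists V.
  apply: ge_ereal_sup => _ [U Uc <-]; apply: htop_cond_le; [by []|exact: ltW|exact: hV].
apply: le_ereal_inf_tmp => _ [V Vc <-]; apply: (le_trans (htop_cond_ge0 V Vc)).
by apply: ereal_sup_ubound; exists V.
Qed.

End EntropyBounds.

(** * Compact metric spaces *)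

Section MetricCovers.
Context {R : realType} {X : metricType R}.
Implicit Types (U V W : {fset set X}) (K : set X) (x y z : X).

(** The sets [A] for which the rest of [K] satisfies [P] form a proper filter, and [x] is a cluster
    point of it. Most compactness arguments below apply this to an ideal of negligible sets. *)
Lemma compact_point (P : set X -> Prop) K : compact K -> P set0 ->
  (forall A B, A `<=` B -> P B -> P A) ->
  (forall A B, P A -> P B -> P (A `|` B)) ->
  ~ P K -> exists2 x, K x & forall r : R, 0 < r -> ~ P (K `&` ball x r).
Proof.
move=> Kco P0 PS PU nPK; pose F : set_system X := [set A | P (K `\` A)].
have FF : ProperFilter F.
  split; first by rewrite /F/= setD0.
  split; first by rewrite /F/= setDT.
    by move=> A B FA FB; rewrite /F/= setDIr; exact: PU.
  by move=> A B AB; apply: PS => y [Ky nBy]; split=> // /AB.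
have [|x [Kx clx]] := Kco F FF; first by rewrite /F/= setDv.
exists x => // r r0 Pr.
have FnB : F (~` ball x r) by rewrite /F/= setDE setCK.
have [y [ny yb]] := clx _ _ FnB (nbhsx_ballx x r r0).
exact: ny.
Qed.

Lemma infinite_limit_point K : compact K -> ~ finite_set K ->
  exists2 x, K x & limit_point K x.
Proof.
move=> Kco Kinf.
have [||x Kx hx] := @compact_point finite_set K Kco (@finite_set0 _) _ _ Kinf.
- by move=> A B; exact: sub_finite_set.
- by move=> A B fA fB; rewrite finite_setU.
exists x => // U /nbhs_ballP[r r0 rU]; apply: contrapT => no.
apply: (hx r r0); apply: (@sub_finite_set _ _ [set x]) => // y [Ky yr].
apply: contrapT => /eqP yx; apply: no; exists y; split=> //; exact: rU.
Qed.

Lemma compact_subsequence_point (u : nat -> X) : compact [set: X] ->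
  exists x, forall (r : R) N, 0 < r -> exists2 n, (N <= n)%N & ball x r (u n).
Proof.
move=> Xco; pose P A := exists N, forall n, (N <= n)%N -> ~ A (u n).
have [||||x _ hx] := @compact_point P _ Xco; rewrite /P.
- by exists 0%N => ? ? [].
- by move=> A B AB [N hN]; exists N => n /hN nB /AB.
- move=> A B [N hN] [M hM]; exists (maxn N M) => n; rewrite geq_max => /andP[Nn Mn].
  by move=> [/(hN _ Nn)|/(hM _ Mn)].
- by move=> [N /(_ N (leqnn N))]; apply.
exists x => r N r0; apply: contrapT => no; apply: (hx r r0); exists N => n Nn [_ b].
by apply: no; exists n.
Qed.

Definition lebesgue_number U (rho : R) : Prop :=
  forall x, exists2 A, A \in U & ball x rho `<=` A.

Lemma exists_lebesgue_number U : compact [set: X] -> open_cover U ->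
  exists2 rho, 0 < rho & lebesgue_number U rho.
Proof.
move=> Xco [Uo UT]; apply: contrapT => no.
pose P (A : set X) := exists2 rho : R, 0 < rho &
  forall x, A x -> exists2 B, B \in U & ball x rho `<=` B.
have [||||x _ hx] := @compact_point P _ Xco; rewrite /P.
- by exists 1.
- by move=> A B AB [r r0 hr]; exists r => // x /AB/hr.
- move=> A B [r r0 hr] [s s0 hs]; exists (Num.min r s); first by rewrite lt_min r0.
  move=> x [/hr|/hs] [C CU rC]; exists C => //; apply: subset_trans rC;
    by apply: le_ball; rewrite ge_min lexx ?orbT.
- by move=> [r r0 hr]; apply: no; exists r => // x; exact: hr.
have [A AU Ax] := coversP UT x.
have /nbhs_ballP[r r0 rA] : nbhs x A by apply: open_nbhs_nbhs; split=> //; exact: Uo.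
have r2 : 0 < r / 2 by rewrite divr_gt0.
apply: (hx _ r2); exists (r / 2) => // y [_ xy]; exists A => // z yz.
by apply: rA; have := ball_triangle xy yz; rewrite -splitr.
Qed.

Lemma lebesgue_numberS U (rho rho' : R) : rho' <= rho ->
  lebesgue_number U rho -> lebesgue_number U rho'.
Proof.
move=> le h x; have [A AU rA] := h x; exists A => //.
by apply: subset_trans rA; exact: le_ball.
Qed.

(** Members are required to be nonempty, so that each lies in a ball around one of its points, as
    the use of a Lebesgue number demands. *)
Definition small_mesh W (rho : R) : Prop := forall A, A \in W ->
  exists2 x, A x & forall y z, A y -> A z -> ball y rho z.

Lemma exists_small_mesh (rho : R) : compact [set: X] -> 0 < rho ->
  exists2 W, open_cover W & small_mesh W rho.
Proof.
move=> Xco rho0; have rho2 : 0 < rho / 2 by rewrite divr_gt0.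
apply: contrapT => no.
pose P (A : set X) := exists W : {fset set X}, [/\ forall B, B \in W -> open B,
  small_mesh W rho & A `<=` \bigcup_(B in [set` W]) B].
have [||||x _ hx] := @compact_point P _ Xco; rewrite /P.
- by exists fset0; split => // B; rewrite in_fset0.
- by move=> A B AB [W [? ? BW]]; exists W; split => //; exact: subset_trans BW.
- move=> A B [W [Wo Ws AW]] [V [Vo Vs BV]]; exists (W `|` V)%fset; split.
  + by move=> C; rewrite in_fsetU => /orP[/Wo|/Vo].
  + by move=> C; rewrite in_fsetU => /orP[/Ws|/Vs].
  + by move=> y [/AW|/BV] [C /= CW Cy]; exists C => //=; rewrite in_fsetU CW ?orbT.
- move=> [W [Wo Ws TW]]; apply: no; exists W => //; split=> //.
  by apply/seteqP; split.
have /nbhs_ballP[r r0 rB] : nbhs x (ball x (rho / 2))^°.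
  by apply: nbhs_interior; exact: nbhsx_ballx.
apply: (hx _ r0); exists [fset (ball x (rho / 2))^°]%fset; split.
- by move=> B; rewrite inE => /eqP ->; exact: open_interior.
- move=> B; rewrite inE => /eqP ->; exists x; first exact: nbhsx_ballx.
  move=> y z /interior_subset xy /interior_subset xz.
  by have := ball_triangle (ball_sym xy) xz; rewrite -splitr.
- by move=> y [_ /rB yB]; exists (ball x (rho / 2))^° => //=; rewrite inE.
Qed.

Lemma small_mesh_refines W U (rho : R) : small_mesh W rho ->
  lebesgue_number U rho -> refines W U.
Proof.
move=> Ws Ul A AW; have [x Ax hA] := Ws A AW; have [B BU xB] := Ul x.
by exists B => // y Ay; apply: xB; exact: hA.
Qed.

Lemma small_mesh_star_refines W U (rho : R) : small_mesh W rho ->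
  lebesgue_number U rho -> star_refines W U.
Proof.
move=> Ws Ul x; have [B BU xB] := Ul x; exists B => // A AW Ax y Ay.
by apply: xB; have [_ _] := Ws A AW; apply.
Qed.

Lemma ball_separation x y : x != y ->
  exists2 r : R, 0 < r & forall z, ball x r z -> ~ ball y r z.
Proof.
rewrite -mdist_gt0 => d0; exists (mdist x y / 2); first by rewrite divr_gt0.
move=> z xz /ball_sym yz; have := ball_triangle xz yz; rewrite -splitr.
by rewrite ballEmdist/= ltxx.
Qed.

Section NullSequence.
Context (x : X) (S : nat -> set X).
Context (Sx : forall i, S i `<=` ball x i.+1%:R^-1).

Lemma near_null_sequence (r : R) : 0 < r ->
  exists N, forall i, (N <= i)%N -> S i `<=` ball x r.
Proof.
move=> r0; exists (Num.truncn r^-1) => i Ni y /Sx.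
apply: le_ball; rewrite invf_ple ?posrE//.
by apply: ltW; apply: lt_le_trans (truncnS_gt _) _; rewrite ler_nat.
Qed.

(** A filter on the union that does not cluster at [x] contains the union of finitely many of the
    [S i], which is compact. *)
Lemma compact_null_union : (forall i, compact (S i)) ->
  compact ([set x] `|` \bigcup_i S i).
Proof.
move=> Sco H PF HK; have [clx|/existsNP[A /existsNP[B /not_implyP[HA]]]] :=
    pselect (cluster H x).
  by exists x; split=> //; left.
move=> /not_implyP[/nbhs_ballP[r r0 rB] nAB].
have [N hN] := near_null_sequence r0.
have : H (\big[setU/set0]_(i < N) S i).
  apply: (@filterS _ H _ (([set x] `|` \bigcup_i S i) `&` A)); last exact: filterI.
  move=> y [[->|[i _ Siy]] Ay].
    by exfalso; apply: nAB; exists x; split=> //; apply: rB; exact: ballxx.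
  rewrite -bigcup_mkord; exists i => //=; rewrite ltnNge; apply/negP => /hN ry.
  by apply: nAB; exists y; split=> //; apply: rB; exact: ry.
move=> HS; have [y [Sy cly]] := @bigsetU_compact X _ (fun i : 'I_N => S i)
  (index_enum _) xpredT (fun i _ => Sco i) H PF HS.
exists y; split=> //; right; move: Sy; rewrite -bigcup_mkord => -[i _ ?].
by exists i.
Qed.

Lemma limit_point_null_union : (forall i, finite_set (S i)) ->
  limit_point ([set x] `|` \bigcup_i S i) `<=` [set x].
Proof.
move=> Sfin z zl; apply: contrapT => /eqP zx.
have [r r0 zr] := ball_separation zx.
have [N hN] := near_null_sequence r0.
have fin : finite_set ((\big[setU/set0]_(i < N) S i) `\` [set z]).
  by apply: finite_setD; rewrite -bigcup_mkord; apply: bigcup_finite.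
have clo : closed ((\big[setU/set0]_(i < N) S i) `\` [set z]).
  apply: (accessible_finite_set_closed.1 _ _ fin).
  exact/hausdorff_accessible/metric_hausdorff.
have nz : nbhs z (~` ((\big[setU/set0]_(i < N) S i) `\` [set z]) `&` ball z r).
  apply: filterI; last exact: nbhsx_ballx.
  by apply: open_nbhs_nbhs; split; [rewrite openC|move=> [_]; apply].
have [y [yz yK [yS yr]]] := zl _ nz.
case: yK => [yx|[i _ Siy]].
  by apply: (zr y yr); rewrite yx; exact: ballxx.
have [Ni|iN] := leqP N i; first exact: (zr y yr) (hN i Ni y Siy).
apply: yS; split; last exact/eqP.
by rewrite -bigcup_mkord; exists i.
Qed.

End NullSequence.

End MetricCovers.

Section Orbits.
Context {R : realType} {G : groupType} {X : metricType R} (act : G -> X -> X).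
Context (act_cont : forall g, continuous (act g)).
Implicit Types (U : {fset set X}) (E : {fset G}) (x y : X).

Lemma orbit_ball E x (rho : R) : 0 < rho ->
  exists2 r : R, 0 < r & forall y, ball x r y ->
    forall g, g \in E -> ball (act g x) rho (act g y).
Proof.
move=> rho0.
have : \forall y \near x, forall g, g \in enum_fset E -> ball (act g x) rho (act g y).
  elim: (enum_fset E) => [|g s IHs]; first exact: nearW.
  have := @act_cont g x _ (nbhsx_ballx (act g x) rho rho0).
  apply: filterS2 IHs => y hs hg h; rewrite in_cons => /predU1P[->//|/hs//].
by move=> /nbhs_ballP[r r0 rP]; exists r => // y /rP.
Qed.

(** From index [m] on, the sets follow the orbit of [x] over [E] so closely that they share a single
    itinerary with [x], whence the term 1. *)
Lemma ncov_null_union U E x (rho : R) (S : nat -> set X) (m : nat) :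
  covers U -> 0 < rho -> lebesgue_number U rho ->
  (forall i y, (m <= i)%N -> S i y -> forall g, g \in E -> ball (act g x) rho (act g y)) ->
  (ncov act U E ([set x] `|` \bigcup_i S i) <= 1 + \sum_(i < m) ncov act U E (S i))%N.
Proof.
move=> UT rho0 Ul hS.
have /choice[w wP] : forall g, exists A, A \in U /\ ball (act g x) rho `<=` A.
  by move=> g; have [A ? ?] := Ul (act g x); exists A.
pose Y := [set x] `|` \bigcup_(i in [set i | (m <= i)%N]) S i.
pose Z := \bigcup_(i in [set i | (i < m)%N]) S i.
apply: (@leq_trans (ncov act U E (Y `|` Z))).
  apply: ncov_sub => // y [->|[i _ Siy]]; first by left; left.
  by have [mi|im] := leqP m i; [left; right|right]; exists i.
apply: leq_trans (ncovU _ _ _ _ UT) _; apply: leq_add.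
  apply: (ncov_name_le1 (w := w)) => [g _|y]; first by have [] := wP g.
  move=> [->|[i mi Siy]] g gE; have [_] := wP g; apply; first exact: ballxx.
  exact: hS Siy g gE.
apply: ncov_bigcup => // y [i im Siy].
by exists (Ordinal im).
Qed.

End Orbits.

(** * Lowering entropy when the tail entropy vanishes *)

Section Lowering.
Context {R : realType} {G : groupType} {X : metricType R} (act : G -> X -> X).
Context (X_compact : compact [set: X]).
Context (act_cont : forall g, continuous (act g)).
Context (F : nat -> {fset G}).
Context (F_folner : folner R F).
Context (F_homo : forall m n, (m <= n)%N -> (F m `<=` F n)%fset).
Context (F_growth : forall e : R, 0 < e ->
  \forall n \near \oo, n.+1%:R <= expR (e * #|` F n|%:R)).
Context (F_large : forall B : R, \forall n \near \oo, B <= #|` F n|%:R).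
Implicit Types (U V W : {fset set X}) (K : set X) (x y : X).

Local Notation ncov := (ncov act).
Local Notation htop := (@htop R G X act F).
Local Notation ncond U V n := (cond_cover_num (dyn_join act U (F n)) (dyn_join act V (F n))).
Local Notation t_ i := (i.+1%:R^-1 : R).

Lemma ler_expR_card (h : R) m n : 0 <= h -> (m <= n)%N ->
  expR (h * #|` F m|%:R) <= expR (h * #|` F n|%:R).
Proof.
move=> h0 mn; rewrite ler_expR ler_wpM2l// ler_nat.
exact/fsubset_leq_card/F_homo.
Qed.

Lemma expR_card_ge1 (h : R) n : 0 <= h -> 1 <= expR (h * #|` F n|%:R).
Proof. by move=> h0; rewrite -[leLHS]expR0 ler_expR mulr_ge0. Qed.

Lemma htop_set1 x : htop [set x] = 0%E.
Proof.
apply/eqP; rewrite eq_le htop_ge0// andbT.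
apply: htop_le => // U Uc h h0; apply: nearW => n.
apply: le_trans (expR_card_ge1 _ (ltW h0)).
rewrite lern1 -[leqRHS]card_unit.
by apply: (@ncov_range _ _ _ _ (fun=> x)); [exact: open_cover_covers|exists tt].
Qed.

Lemma inv_succ_le (rho : R) : 0 < rho ->
  exists N, forall i, (N <= i)%N -> t_ i <= rho.
Proof.
move=> rho0; exists (Num.truncn rho^-1) => i Ni.
rewrite invf_ple ?posrE//; apply: ltW.
by apply: lt_le_trans (truncnS_gt _) _; rewrite ler_nat.
Qed.

(** Over [F m], the sets of index at least [m] cost one itinerary together with [x], those below [N]
    a constant, and the at most [m] others a polynomial factor, which the growth of the Folner sets
    absorbs. *)
Lemma null_union_growth U x (S : nat -> set X) (C c : R) (N : nat) :
  open_cover U -> 0 <= C -> 0 <= c ->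
  (forall i, finite_set (S i)) ->
  (forall i y, S i y -> forall g, g \in F i -> ball (act g x) (t_ i) (act g y)) ->
  (forall i m, (N <= i)%N ->
     (ncov U (F m) (S i))%:R <= C * m.+1%:R * expR (c * #|` F m|%:R)) ->
  forall c', c < c' -> \forall m \near \oo,
    (ncov U (F m) ([set x] `|` \bigcup_i S i))%:R <= expR (c' * #|` F m|%:R).
Proof.
move=> Uc C0 c0 Sfin Sx SC c' cc'; have UT := open_cover_covers Uc.
have [rho rho0 Urho] := exists_lebesgue_number X_compact Uc.
have [N' tN'] := inv_succ_le rho0.
have /choice[k_ kP] : forall i, exists k, forall U E, covers U -> (ncov U E (S i) <= k)%N.
  by move=> i; exact: ncov_finite.
pose B := (\sum_(i < N) k_ i)%N.
apply: filterS3 (nbhs_infty_ge N') (nbhs_infty_ge N)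
  (near_mul_sqr_expR F_large (B.+1%:R + C) cc' F_growth) => m /= N'm Nm.
apply: le_trans.
apply: (@le_trans _ _ (1 + \sum_(i < m) ncov U (F m) (S i))%:R).
  rewrite ler_nat; apply: (ncov_null_union UT rho0 Urho) => i y mi Sy g gm.
  apply: le_ball (tN' i (leq_trans N'm mi)) _ _.
  by apply: Sx => //; exact: (fsubsetP (F_homo mi)).
have e1 := expR_card_ge1 m c0.
set em := expR (c * _) in e1 *.
have bnd i : (ncov U (F m) (S i))%:R <=
    (if (i < N)%N then k_ i else 0%N)%:R + C * m.+1%:R * em.
  case: ltnP => iN; last by rewrite add0r; exact: SC.
  apply: (@le_trans _ _ (k_ i)%:R); first by rewrite ler_nat kP.
  by rewrite lerDl !mulr_ge0// (le_trans _ e1).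
have sB : (\sum_(i < m) (if (i < N)%N then k_ i else 0))%N = B.
  rewrite /B -(big_mkord xpredT (fun i => if (i < N)%N then k_ i else 0%N)).
  rewrite (big_cat_nat (n := N))//= [X in (_ + X)%N]big_nat_cond [X in (_ + X)%N]big1 ?addn0.
    by rewrite big_mkord; apply: eq_bigr => i _; rewrite ltn_ord.
  by move=> i /andP[/andP[Ni _] _]; rewrite ltnNge Ni.
rewrite natrD natr_sum; apply: (@le_trans _ _ (1 + (B%:R + m%:R * (C * m.+1%:R * em)))).
  rewrite lerD2l (@le_trans _ _ (\sum_(i < m)
    ((if (i < N)%N then k_ i else 0%N)%:R + C * m.+1%:R * em)))//; first exact: ler_sum.
  by rewrite big_split/= -natr_sum sB sumr_const card_ord [m%:R * _]mulr_natl.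
have em0 : 0 <= em by apply: le_trans e1.
have m1 : 1 <= m.+1%:R ^+ 2 :> R by rewrite exprn_ege1// ler1n.
have h1 : B.+1%:R * 1 <= B.+1%:R * (m.+1%:R ^+ 2 * em).
  by rewrite ler_wpM2l// -[leLHS]mulr1 ler_pM.
have h2 : (C * m.+1%:R * em) * m%:R <= (C * m.+1%:R * em) * m.+1%:R.
  by rewrite ler_wpM2l ?ler_nat// !mulr_ge0.
by rewrite expr2 in h1 *; rewrite -[in B.+1%:R]natr1 in h1 *; lra.
Qed.

(** The sets whose complexity, in every cover, grows at a common rate below [h] form an ideal that
    does not contain [K]. *)
Lemma htop_local_point K (h : R) : compact K -> 0 < h -> (h%:E <= htop K)%E ->
  exists2 x, K x & forall (r h' : R), 0 < r -> 0 <= h' -> h' < h ->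
    exists2 U, open_cover U & forall N, exists2 n, (N <= n)%N &
      expR (h' * #|` F n|%:R) < (ncov U (F n) (K `&` ball x r))%:R.
Proof.
move=> Kco h0 hK.
pose P A := exists2 h' : R, 0 <= h' < h & forall U, open_cover U ->
  \forall n \near \oo, (ncov U (F n) A)%:R <= expR (h' * #|` F n|%:R).
have [||||x Kx hx] := @compact_point _ _ P K Kco; rewrite /P.
- by exists 0 => [|U _]; [rewrite lexx|apply: nearW => n; rewrite ncov_set0 expR_ge0].
- move=> A B AB [h' h'0 hU]; exists h' => // U Uc; apply: filterS (hU U Uc) => n.
  by apply: le_trans; rewrite ler_nat ncov_sub//; exact: open_cover_covers.
- move=> A B [a /andP[a0 ah] hA] [b /andP[b0 bh] hB].
  pose c := (Num.max a b + h) / 2.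
  have mh : Num.max a b < h by rewrite gt_max ah.
  have m0 : 0 <= Num.max a b by rewrite le_max a0.
  exists c => [|U Uc]; first by apply/andP; split; rewrite /c; lra.
  have mc : Num.max a b < c by rewrite /c; lra.
  apply: filterS3 (hA U Uc) (hB U Uc) (near_mul_expR F_large 2 mc) => n An Bn.
  apply: le_trans; apply: (@le_trans _ _ ((ncov U (F n) A)%:R + (ncov U (F n) B)%:R)).
    by rewrite -natrD ler_nat ncovU//; exact: open_cover_covers.
  rewrite mulr_natl mulr2n lerD//.
    by apply: le_trans An _; rewrite ler_expR ler_wpM2r// le_max lexx.
  by apply: le_trans Bn _; rewrite ler_expR ler_wpM2r// le_max lexx orbT.
- move=> [h' /andP[h'0 h'h] hU]; move: hK; apply/negP; rewrite -ltNge.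
  apply: (@le_lt_trans _ _ h'%:E); last by rewrite lte_fin.
  apply: htop_le => // U Uc h'' hh; apply: filterS (hU U Uc) => n /le_trans; apply.
  by rewrite ler_expR ler_wpM2r// ltW.
exists x => // r h' r0 h'0 h'h; apply: contrapT => no; apply: (hx r r0).
exists h' => [|U Uc]; first by rewrite h'0.
apply: contrapT => nn; apply: no; exists U => // N; apply: contrapT => noN; apply: nn.
exists N => // n /= Nn; rewrite leNgt; apply/negP => h2; apply: noN; by exists n.
Qed.

Context (V : nat -> {fset set X}).
Context (V_open : forall i, open_cover (V i)).
Context (V_tail : forall i U, open_cover U ->
  \forall n \near \oo, (ncond U (V i) n)%:R <= expR (t_ i * #|` F n|%:R)).

(** Passing from any [U] to [V j] lowers the rate by at most [t_ j]: one cover sees the entropy up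
    to the tail. *)
Lemma ncov_cond_expR j U n (a : R) K : open_cover U ->
  (ncond U (V j) n)%:R <= expR (t_ j * #|` F n|%:R) ->
  expR (a * #|` F n|%:R) < (ncov U (F n) K)%:R ->
  expR ((a - t_ j) * #|` F n|%:R) < (ncov (V j) (F n) K)%:R.
Proof.
move=> Uc hc ha; have UT := open_cover_covers Uc.
rewrite mulrBl expRD expRN ltr_pdivrMr ?expR_gt0//.
apply: lt_le_trans ha _; apply: (@le_trans _ _ ((ncov (V j) (F n) K)%:R * (ncond U (V j) n)%:R)).
  by rewrite -natrM ler_nat ncov_le_mul_cond//; exact: open_cover_covers.
by rewrite ler_wpM2l.
Qed.

(* [n] is the first time after [N0] at which [K `&` ball x r] has complexity
   [e^(c|F n|)]; a separated subset of about that size cannot be more complex at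
   earlier times, nor at later ones by its cardinality. *)
Lemma lowering_piece K x (h : R) (i : nat) : 0 < h ->
  (forall (r : R) j h', 0 < r -> h' < h -> forall N, exists2 n, (N <= n)%N &
     expR ((h' - t_ j) * #|` F n|%:R) < (ncov (V j) (F n) (K `&` ball x r))%:R) ->
  exists (n : nat) (E : set X), [/\ (i <= n)%N, finite_set E,
    E `<=` K `&` ball x (t_ i),
    (forall y, E y -> forall g, g \in F i -> ball (act g x) (t_ i) (act g y)) &
    (forall U, covers U -> lebesgue_number U (t_ i) -> forall m,
       (ncov U (F m) E)%:R <= 2 * expR (h * #|` F m|%:R)) /\
    (forall j, (j <= i)%N ->
       expR ((h - 2 * t_ i - t_ j) * #|` F n|%:R) <= (ncov (V j) (F n) E)%:R)].
Proof.
move=> h0 hx; have ti0 : 0 < t_ i by rewrite invr_gt0.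
have [rho rho0 Vrho] := exists_lebesgue_number X_compact (V_open i).
have mn0 : 0 < Num.min rho (t_ i) by rewrite lt_min rho0.
(* The cover [W] refines [V i] and every [U] with Lebesgue number [t_ i]; below, [W'] star-refines
   [W], so that complexity in [W] yields points separated in [W']. *)
have [W Wc Wmesh] := exists_small_mesh X_compact mn0.
have WT := open_cover_covers Wc.
have WV : refines W (V i).
  by apply: small_mesh_refines Wmesh _; apply: lebesgue_numberS Vrho; rewrite ge_min lexx.
have WU U : lebesgue_number U (t_ i) -> refines W U.
  move=> Ul; apply: small_mesh_refines Wmesh _; apply: lebesgue_numberS Ul.
  by rewrite ge_min lexx orbT.
have [rho2 rho20 Wrho2] := exists_lebesgue_number X_compact Wc.
have [W' W'c W'mesh] := exists_small_mesh X_compact rho20.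
have W'T := open_cover_covers W'c.
have W'W := small_mesh_star_refines W'mesh Wrho2.
(* From [N0] on, each [V j] with [j <= i] controls [W'] at rate [t_ j]. *)
have [N0 N0P] : exists N0, (i <= N0)%N /\ forall n, (N0 <= n)%N ->
    forall j : 'I_i.+1, (ncond W' (V j) n)%:R <= expR (t_ j * #|` F n|%:R).
  have [N _ hN] : \forall n \near \oo, forall j : 'I_i.+1,
      (ncond W' (V j) n)%:R <= expR (t_ j * #|` F n|%:R).
    by apply: filter_forall => j; exact: V_tail.
  exists (maxn i N); split; first exact: leq_maxl.
  by move=> n; rewrite geq_max => /andP[_ /hN].
case: N0P => iN0 tailN0.
have [r r0 orb] := orbit_ball act_cont (F N0) x ti0.
pose r' := Num.min r (t_ i); have r'0 : 0 < r' by rewrite lt_min r0.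
(* One [t_ i] brings the rate strictly below [h]; the other is lost in passing to [V i]. *)
pose c := h - 2 * t_ i.
have hK : exists n, (N0 <= n)%N && (expR (c * #|` F n|%:R) < (ncov W (F n) (K `&` ball x r'))%:R).
  have [|n Nn hn] := hx r' i (h - t_ i) r'0 _ N0; first by rewrite ltrBlDr ltrDl.
  exists n; rewrite Nn/=; apply: (@lt_le_trans _ _ (ncov (V i) (F n) (K `&` ball x r'))%:R).
    by move: hn; rewrite (_ : h - t_ i - t_ i = c)// /c; ring.
  by rewrite ler_nat ncov_refines.
case: (ex_minnP hK) => n /andP[N0n hn] nmin.
pose k := (Num.truncn (expR (c * #|` F n|%:R))).+1.
have kn : (k <= ncov W (F n) (K `&` ball x r'))%N.
  rewrite /k -(ltr_nat R); apply: le_lt_trans hn.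
  by rewrite truncn_le// expR_ge0.
have [e esep eK] := exists_separated W'W kn.
have kge : expR (c * #|` F n|%:R) <= k%:R by rewrite ltW// truncnS_gt.
have ch : c <= h by rewrite /c lerBlDr lerDl mulr_ge0// ltW.
have kle : k%:R <= 2 * expR (h * #|` F n|%:R).
  have : expR (c * #|` F n|%:R) <= expR (h * #|` F n|%:R) by rewrite ler_expR ler_wpM2r.
  have : (Num.truncn (expR (c * #|` F n|%:R)))%:R <= expR (c * #|` F n|%:R).
    by rewrite truncn_le// expR_ge0.
  have := expR_card_ge1 n (ltW h0).
  by rewrite /k -natr1; lra.
have eball y : range e y -> ball x r y /\ ball x (t_ i) y.
  by move=> /eK[_ xy]; split; move: xy; apply: le_ball; rewrite ge_min lexx ?orbT.
exists n, (range e); split.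
- exact: leq_trans iN0 N0n.
- exact/finite_image/finite_finset.
- by move=> y ye; split; [have [] := eK y ye|have [] := eball y ye].
- move=> y /eball[xy _] g gFi; apply: orb => //.
  exact: (fsubsetP (F_homo iN0)).
split=> [U UT Ul m|j ji].
  (* Up to [N0] the points all follow [x]; from [n] on, their number is a sufficient bound; in
     between, the minimality of [n] applies. *)
  have [mN0|N0m] := leqP m N0.
    apply: (@le_trans _ _ 1); last by have := expR_card_ge1 m (ltW h0); lra.
    have /choice[w wP] : forall g, exists A, A \in U /\ ball (act g x) (t_ i) `<=` A.
      by move=> g; have [A ? ?] := Ul (act g x); exists A.
    rewrite lern1; apply: (ncov_name_le1 (w := w)) => [g _|y /eball[xy _] g gm].
      by have [] := wP g.
    have [_] := wP g; apply; apply: orb => //.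
    exact: (fsubsetP (F_homo mN0)).
  have [nm|mn] := leqP n m.
    apply: (@le_trans _ _ k%:R).
      by rewrite ler_nat -[leqRHS]card_ord; apply: (@ncov_range _ _ _ _ e).
    by apply: le_trans kle _; rewrite ler_wpM2l//; exact: ler_expR_card (ltW h0) nm.
  have hm : (ncov W (F m) (K `&` ball x r'))%:R <= expR (c * #|` F m|%:R).
    rewrite leNgt; apply/negP => hm; have := nmin m; rewrite hm (ltnW N0m) => /(_ isT).
    by rewrite leqNgt mn.
  apply: (@le_trans _ _ (ncov W (F m) (K `&` ball x r'))%:R).
    rewrite ler_nat; apply: leq_trans (ncov_refines act _ _ WT (WU U Ul)) _.
    exact: ncov_sub.
  apply: le_trans hm _; have : expR (c * #|` F m|%:R) <= expR (h * #|` F m|%:R).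
    by rewrite ler_expR ler_wpM2r.
  by have := expR_ge0 (h * #|` F m|%:R); lra.
(* The [k] separated points have complexity at least [k] in [W'], hence also in [V j] up to the
   conditional factor. *)
have hj := tailN0 n N0n (Ordinal (ji : (j < i.+1)%N)).
rewrite -/c mulrBl expRD expRN ler_pdivrMr ?expR_gt0//; apply: le_trans kge _.
apply: (@le_trans _ _ ((ncov (V j) (F n) (range e))%:R * (ncond W' (V j) n)%:R)); last first.
  by rewrite ler_wpM2l.
rewrite -natrM ler_nat; apply: leq_trans (ncov_le_mul_cond act _ _ W'T _); last first.
  exact: open_cover_covers.
by rewrite -[X in (X <= _)%N]card_ord; exact: ncov_separated.
Qed.

Lemma lowering_subset K (h : R) : compact K -> 0 < h -> (h%:E <= htop K)%E ->
  exists Kh : set X, [/\ compact Kh, Kh !=set0, Kh `<=` K,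
    is_subset1 (limit_point Kh) & htop Kh = h%:E].
Proof.
move=> Kco h0 hK; have [x Kx hx] := htop_local_point Kco h0 hK.
have hV (r : R) j h' : 0 < r -> h' < h -> forall N, exists2 n, (N <= n)%N &
    expR ((h' - t_ j) * #|` F n|%:R) < (ncov (V j) (F n) (K `&` ball x r))%:R.
  move=> r0 h'h N; pose h'' := Num.max 0 h'.
  have [||U Uc hU] := hx r h'' r0; rewrite /h''; first by rewrite le_max lexx.
    by rewrite gt_max h0.
  have [M _ hM] := V_tail j Uc.
  have [n] := hU (maxn N M); rewrite geq_max => /andP[Nn /hM Mn hn]; exists n => //.
  apply: ncov_cond_expR Uc Mn _ => //; apply: le_lt_trans hn.
  by rewrite ler_expR ler_wpM2r// le_max lexx orbT.
have /choice[n_ /choice[E_ EP]] := fun i => @lowering_piece K x h i h0 hV.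
have EK i : E_ i `<=` ball x (t_ i) by have [_ _ + _ _] := EP i => H y /H[].
exists ([set x] `|` \bigcup_i E_ i); split.
- by apply: compact_null_union EK _ => i; apply: finite_compact; have [] := EP i.
- by exists x; left.
- by move=> y [->//|[i _ Ey]]; have [_ _ H _ _] := EP i; have [] := H y Ey.
- have lim := limit_point_null_union EK (fun i => let: And5 _ f _ _ _ := EP i in f).
  by move=> y z /lim -> /lim ->.
apply/eqP; rewrite eq_le; apply/andP; split.
  apply: (htop_le F_folner) => [|U Uc h' hh']; first exact: ltW.
  have [rho rho0 Urho] := exists_lebesgue_number X_compact Uc.
  have [N tN] := inv_succ_le rho0.
  apply: (null_union_growth (C := 2) (N := N) Uc _ (ltW h0) _ _ _ hh') => //.
  - by move=> i; have [] := EP i.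
  - by move=> i; have [_ _ _] := EP i.
  move=> i m Ni; have [_ _ _ _ [H _]] := EP i.
  apply: (@le_trans _ _ (2 * expR (h * #|` F m|%:R))).
    by apply: H; [exact: open_cover_covers|exact: lebesgue_numberS (tN i Ni) Urho].
  by rewrite ler_wpM2r ?expR_ge0// -[leLHS]mulr1 ler_wpM2l// ler1n.
apply: htop_ge => // h' h'h.
have d0 : 0 < (h - h') / 3 by rewrite divr_gt0// subr_gt0.
(* For [i >= j] the loss [2 * t_ i + t_ j] is at most [3 * t_ j], hence at most [h - h']; the cover
   [V j] is fixed while [i] grows. *)
have [j /(_ j (leqnn j)) tj] := inv_succ_le d0.
exists (V j); first exact: V_open.
move=> N; pose i := maxn N j.
have [+ _ _ _ [_ low]] := EP i => i_n.
exists (n_ i); first by apply: leq_trans i_n; exact: leq_maxl.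
have ji : (j <= i)%N by rewrite leq_maxr.
apply: (@le_trans _ _ (ncov (V j) (F (n_ i)) (E_ i))%:R); last first.
  rewrite ler_nat ncov_sub//; first exact: open_cover_covers.
  by move=> y Ey; right; exists i.
apply: le_trans (low j ji); rewrite ler_expR ler_wpM2r//.
have tij : t_ i <= t_ j by rewrite lef_pV2 ?posrE// ler_nat.
by move: (t_ i) (t_ j) tij tj => a b ab bh; lra.
Qed.

End Lowering.

(** * Tail points *)

Section TailSets.
Context {R : realType} {G : groupType} {X : metricType R} (act : G -> X -> X).
Context (X_compact : compact [set: X]).
Context (actM : forall g h x, act (g * h)%g x = act g (act h x)).
Context (act_cont : forall g, continuous (act g)).
Context (F : nat -> {fset G}).
Context (F_folner : folner R F).
Context (F_homo : forall m n, (m <= n)%N -> (F m `<=` F n)%fset).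
Context (F_growth : forall e : R, 0 < e ->
  \forall n \near \oo, n.+1%:R <= expR (e * #|` F n|%:R)).
Context (F_large : forall B : R, \forall n \near \oo, B <= #|` F n|%:R).
Implicit Types (U V W : {fset set X}) (K : set X) (x y : X).

Local Notation ncov := (ncov act).
Local Notation name_set := (name_set act).
Local Notation htop := (@htop R G X act F).
Local Notation ncond U V n := (cond_cover_num (dyn_join act U (F n)) (dyn_join act V (F n))).
Local Notation t_ i := (i.+1%:R^-1 : R).

(** The same [n] serves every [M]: the itinerary in [V] can be prescribed for times far beyond the
    one at which the complexity in [U] is observed. *)
Definition tail_point U V (b : R) x : Prop :=
  forall (r : R) (N : nat), 0 < r -> exists2 n, (N <= n)%N &
    forall M, exists2 w, (forall g, g \in F M -> w g \in V) &
      expR (b * #|` F n|%:R) < (ncov U (F n) (name_set (F M) w `&` ball x r))%:R.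

(* Were all tail points in the finite set [Q], orbits could be tiled: near [Q] by
   tiles of bounded complexity, and away from [Q] by those of complexity below [a]. *)
Lemma exists_tail_point U V (a b : R) (Q : seq X) : open_cover U ->
  0 <= b -> b < a ->
  ~ (\forall n \near \oo, (ncond U V n)%:R <= expR (a * #|` F n|%:R)) ->
  exists2 x, x \notin Q & tail_point U V b x.
Proof.
move=> Uc b0 ba; have UT := open_cover_covers Uc.
apply: contra_notP => noQ.
pose a' := (a + b) / 2.
have ba' : b < a' by rewrite /a'; lra.
have a'a : a' < a by rewrite /a'; lra.
have a'0 : 0 < a' by lra.
apply: (tileable_cond_cover_num actM F_folner F_homo F_large UT (ltW a'0) a'a) => N.
have [N0 _ hN0] := near_mul_expR F_large (size Q)%:R a'0.
pose n0 := maxn N N0.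
have Qn0 : (size Q)%:R <= expR (a' * #|` F n0|%:R).
  have := hN0 n0 (leq_maxr N N0); rewrite /= mul0r expR0 mulr1//.
have [rho rho0 Urho] := exists_lebesgue_number X_compact Uc.
have /choice[r_ rP] : forall q : X, exists r : R, 0 < r /\ forall y, ball q r y ->
    forall g, g \in F n0 -> ball (act g q) rho (act g y).
  by move=> q; have [r r0 hr] := orbit_ball act_cont (F n0) q rho0; exists r.
pose W := \bigcup_(q in [set` Q]) (ball q (r_ q))^°.
have Wo : open W by apply: bigcup_open => q _; exact: open_interior.
have Lco : compact (~` W) by apply: (subclosed_compact _ X_compact) => //; exact: open_closedC.
(* The negation of being a tail point, in a form stable under finite unions: the room between [lam]
   and [a'] absorbs a factor 2. *)
pose P A := exists2 lam, lam < a' & exists N, forall n, (N <= n)%N ->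
  exists M, forall w, (forall g, g \in F M -> w g \in V) ->
    (ncov U (F n) (name_set (F M) w `&` A))%:R <= expR (lam * #|` F n|%:R).
have PS A B : A `<=` B -> P B -> P A.
  move=> AB [lam lama [N1 hN1]]; exists lam => //; exists N1 => n /hN1[M hM].
  exists M => w /hM; apply: le_trans; rewrite ler_nat ncov_sub//.
  by move=> y [yw /AB].
have PL : P (~` W).
  apply: contrapT => nPL.
  have [||x Wx hx] := compact_point Lco _ PS _ nPL.
  - exists 0 => //; exists 0%N => n _; exists 0%N => w _.
    by rewrite setI0 ncov_set0 expR_ge0.
  - move=> A B [l la [M hM]] [m ma [N1 hN1]].
    pose c := Num.max l m; have ca : c < a' by rewrite gt_max la.
    have cm : c < (c + a') / 2 by lra.
    exists ((c + a') / 2); first lra.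
    have [N2 _ hN2] := near_mul_expR F_large 2 cm.
    exists (maxn (maxn M N1) N2) => n; rewrite !geq_max.
    move=> /andP[/andP[/hM[M' hM'] /hN1[N' hN']] /hN2 h2].
    exists (maxn M' N') => w wV.
    have wV1 g : g \in F M' -> w g \in V.
      by move=> gM; apply: wV; apply: (fsubsetP (F_homo (leq_maxl M' N'))).
    have wV2 g : g \in F N' -> w g \in V.
      by move=> gM; apply: wV; apply: (fsubsetP (F_homo (leq_maxr M' N'))).
    apply: le_trans h2; rewrite mulr_natl mulr2n.
    apply: (@le_trans _ _ ((ncov U (F n) (name_set (F M') w `&` A))%:R +
        (ncov U (F n) (name_set (F N') w `&` B))%:R)).
      rewrite -natrD ler_nat; apply: leq_trans (ncovU _ _ _ _ UT).
      apply: ncov_sub => // y [yw [Ay|By]]; [left|right]; split=> // g gM; apply: yw.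
        exact: (fsubsetP (F_homo (leq_maxl M' N'))).
      exact: (fsubsetP (F_homo (leq_maxr M' N'))).
    apply: lerD.
      by apply: le_trans (hM' _ wV1) _; rewrite ler_expR ler_wpM2r// le_max lexx.
    by apply: le_trans (hN' _ wV2) _; rewrite ler_expR ler_wpM2r// le_max lexx orbT.
  (* The point lies outside [W], hence outside [Q], and it is a tail point, as otherwise a ball
     around it would satisfy [P] with rate [b]. *)
  apply: noQ; exists x.
    apply/negP => xQ; apply: Wx; exists x => //; apply: nbhsx_ballx.
    by have [] := rP x.
  move=> r M r0; apply: contrapT => no; apply: (hx r r0).
  apply: (PS _ (ball x r)) => [y []//|]; exists b => //; exists M => n Mn.
  apply: contrapT => no2; apply: no; exists n => // M'; apply: contrapT => no3.
  apply: no2; exists M' => w wV; rewrite leNgt; apply/negP => h; apply: no3.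
  by exists w.
have [lam lama [N1 hN1]] := PL.
pose n1 := maxn N N1; have [M1 hM1] := hN1 n1 (leq_maxr _ _).
(* Tiles of size [n0] start in [W] and need at most one itinerary per entry of [Q]; those of size
   [n1] start outside [W]. *)
exists (fun c : bool => if c then n0 else n1), (maxn M1 (maxn n0 n1)).
exists (fun c : bool => if c then W else ~` W); split.
- case; apply/andP; split; rewrite ?leq_maxl//.
    exact: leq_trans (leq_maxl _ _) (leq_maxr _ _).
  exact: leq_trans (leq_maxr _ _) (leq_maxr _ _).
- by move=> x; have [|] := pselect (W x); [left|right].
case=> v vV.
  apply: le_trans Qn0; rewrite ler_nat -[leqRHS]card_ord.
  have /choice[s sP] : forall x, exists A, A \in U /\ ball x rho `<=` A.
    by move=> x; have [A AU Ax] := Urho x; exists A.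
  apply: (@ncov_le _ _ _ _ (fun i g => s (act g (tnth (in_tuple Q) i)))) => [i g _|y].
    by have [] := sP (act g (tnth (in_tuple Q) i)).
  move=> [_ [q /= /(tnthP (in_tuple Q))[i qE] /interior_subset qy]].
  exists i => g gn; rewrite -qE; have [_] := sP (act g q); apply.
  by have [_] := rP q; apply.
have vV1 g : g \in F M1 -> v g \in V.
  by move=> gM; apply: vV; apply: (fsubsetP (F_homo (leq_maxl _ _))).
apply: (@le_trans _ _ (ncov U (F n1) (name_set (F M1) v `&` ~` W))%:R).
  rewrite ler_nat; apply: ncov_sub => // y [yv yW]; split=> // g gM; apply: yv.
  exact: (fsubsetP (F_homo (leq_maxl _ _))).
apply: le_trans (hM1 _ vV1) _; by rewrite ler_expR ler_wpM2r// ltW.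
Qed.

(* The pieces of [K] follow a common itinerary in [V] for so long that afterwards
   their cardinality is negligible, whence the bound on [ncov V]. *)
Lemma exists_tail_set U V (b e delta : R) x : open_cover U -> open_cover V ->
  0 < b -> 0 < e -> 0 < delta -> tail_point U V b x ->
  exists K, [/\ compact K, K !=set0, K `<=` ball x delta,
    limit_point K `<=` [set x] & (b%:E <= htop K)%E /\
    forall m, (ncov V (F m) K)%:R <= 1 + m%:R * expR (e * #|` F m|%:R)].
Proof.
move=> Uc Vc b0 e0 delta0 xt.
have UT := open_cover_covers Uc; have VT := open_cover_covers Vc.
have [rho rho0 Urho] := exists_lebesgue_number X_compact Uc.
have [rhoV rhoV0 Vrho] := exists_lebesgue_number X_compact Vc.
have [U' U'c U'mesh] := exists_small_mesh X_compact rho0.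
have U'T := open_cover_covers U'c.
have U'U := small_mesh_star_refines U'mesh Urho.
have pieces i : exists E : set X, [/\ finite_set E, E `<=` ball x (t_ i), E `<=` ball x delta,
    (forall y, E y -> forall g, g \in F i -> ball (act g x) rhoV (act g y)) &
    (forall m, (ncov V (F m) E)%:R <= expR (e * #|` F m|%:R)) /\
    exists2 n, (i <= n)%N & expR (b * #|` F n|%:R) <= (ncov U' (F n) E)%:R].
  have [r r0 orb] := orbit_ball act_cont (F i) x rhoV0.
  pose r' := Num.min r (Num.min (t_ i) delta).
  have r'0 : 0 < r' by rewrite !lt_min r0 invr_gt0 ltr0n.
  have [n ni hn] := xt r' i r'0.
  pose k := (Num.truncn (expR (b * #|` F n|%:R))).+1.
  (* As [n], and so [k], is known before [M], the latter can be taken so large that [k] is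
     negligible beyond [F M]. *)
  have [M _ hM] := F_large (ln k%:R / e).
  have [w wV kw] := hn M.
  have kn : (k <= ncov U (F n) (name_set (F M) w `&` ball x r'))%N.
    by rewrite /k -(ltr_nat R); apply: le_lt_trans kw; rewrite truncn_le// expR_ge0.
  have [f fsep fK] := exists_separated U'U kn.
  have fball y : range f y -> [/\ ball x r y, ball x (t_ i) y & ball x delta y].
    move=> /fK[_ xy]; split; move: xy; apply: le_ball;
      by rewrite /r' !ge_min lexx ?orbT.
  exists (range f); split.
  - exact/finite_image/finite_finset.
  - by move=> y /fball[].
  - by move=> y /fball[].
  - by move=> y /fball[xy _ _] g gi; apply: orb.
  split=> [m|]; last first.
    exists n => //; apply: (@le_trans _ _ k%:R); first by rewrite ltW// truncnS_gt.
    by rewrite ler_nat -[leqLHS]card_ord; exact: ncov_separated.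
  have [mM|Mm] := leqP m M.
    apply: (@le_trans _ _ 1); last exact: (expR_card_ge1 _ _ (ltW e0)).
    rewrite lern1; apply: (ncov_name_le1 (w := w)) => [g gm|y /fK[yw _] g gm].
      by apply: wV; exact: (fsubsetP (F_homo mM)).
    by apply: yw; exact: (fsubsetP (F_homo mM)).
  apply: (@le_trans _ _ k%:R).
    by rewrite ler_nat -[leqRHS]card_ord; apply: (@ncov_range _ _ _ _ f).
  have := hM m (ltnW Mm); rewrite /= ler_pdivrMr// mulrC => le.
  by rewrite -[leLHS]lnK ?posrE ?ltr0n// ler_expR.
have /choice[E_ EP] := pieces.
have EK i : E_ i `<=` ball x (t_ i) by have [] := EP i.
have Efin i : finite_set (E_ i) by have [] := EP i.
exists ([set x] `|` \bigcup_i E_ i); split.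
- by apply: compact_null_union EK _ => i; exact: finite_compact.
- by exists x; left.
- by move=> y [->|[i _ Ey]]; [exact: ballxx|have [_ _ H _ _] := EP i; exact: H].
- exact: limit_point_null_union.
split=> [|m].
  apply: htop_ge => // h hb; exists U' => // N.
  have [_ _ _ _ [_ [n Nn hn]]] := EP N; exists n => //.
  apply: (@le_trans _ _ (ncov U' (F n) (E_ N))%:R); last first.
    by rewrite ler_nat ncov_sub// => y Ey; right; exists N.
  by apply: le_trans hn; rewrite ler_expR ler_wpM2r// ltW.
apply: (@le_trans _ _ (1 + \sum_(i < m) ncov V (F m) (E_ i))%:R).
  rewrite ler_nat; apply: (ncov_null_union VT rhoV0 Vrho) => i y mi Ey g gm.
  by have [_ _ _ H _] := EP i; apply: H => //; exact: (fsubsetP (F_homo mi)).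
rewrite natrD natr_sum lerD2l.
apply: (@le_trans _ _ (\sum_(i < m) expR (e * #|` F m|%:R))).
  by apply: ler_sum => i _; have [_ _ _ _ [H _]] := EP i.
by rewrite sumr_const card_ord [leRHS]mulr_natl.
Qed.

Lemma htop_setU_le K Y (c : R) : 0 <= c -> (htop K <= c%:E)%E ->
  (htop Y <= c%:E)%E -> (htop (K `|` Y) <= c%:E)%E.
Proof.
move=> c0 Kc Yc; apply: htop_le => // U Uc h ch.
have cm : c < (c + h) / 2 by lra.
have mh : (c + h) / 2 < h by lra.
have Km : (htop K < ((c + h) / 2)%:E)%E by apply: le_lt_trans Kc _; rewrite lte_fin.
have Ym : (htop Y < ((c + h) / 2)%:E)%E by apply: le_lt_trans Yc _; rewrite lte_fin.
apply: filterS3 (htop_lt F_folner Km Uc) (htop_lt F_folner Ym Uc)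
  (near_mul_expR F_large 2 mh) => n hK hY; apply: le_trans.
rewrite mulr_natl mulr2n (le_trans _ (lerD hK hY))// -natrD ler_nat.
by apply: ncovU; exact: open_cover_covers.
Qed.

End TailSets.

(** * Failure of lowerability when the tail entropy is positive *)

Section Converse.
Context {R : realType} {G : groupType} {X : metricType R} (act : G -> X -> X).
Context (X_compact : compact [set: X]).
Context (actM : forall g h x, act (g * h)%g x = act g (act h x)).
Context (act_cont : forall g, continuous (act g)).
Context (F : nat -> {fset G}).
Context (F_folner : folner R F).
Context (F_homo : forall m n, (m <= n)%N -> (F m `<=` F n)%fset).
Context (F_growth : forall e : R, 0 < e ->
  \forall n \near \oo, n.+1%:R <= expR (e * #|` F n|%:R)).
Context (F_large : forall B : R, \forall n \near \oo, B <= #|` F n|%:R).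
Implicit Types (U V W : {fset set X}) (K : set X) (x y : X).

Local Notation ncov := (ncov act).
Local Notation htop := (@htop R G X act F).
Local Notation ncond U V n := (cond_cover_num (dyn_join act U (F n)) (dyn_join act V (F n))).
Local Notation t_ i := (i.+1%:R^-1 : R).

Lemma exists_injective_sequence (P : nat -> X -> Prop) :
  (forall j (Q : seq X), exists2 x, x \notin Q & P j x) ->
  exists2 u : nat -> X, injective u & forall j, P j (u j).
Proof.
move=> hP; have /choice[f fP] : forall p : nat * seq X, exists x, x \notin p.2 /\ P p.1 x.
  by move=> [j Q]; have [x] := hP j Q; exists x.
pose s j := iteri j (fun i Q => f (i, Q) :: Q) [::].
pose u j := f (j, s j).
have us i j : (i < j)%N -> u i \in s j.
  elim: j => // j IHj; rewrite ltnS leq_eqVlt => /predU1P[->|/IHj].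
    by rewrite /s iteriS mem_head.
  by rewrite [X in _ -> _ \in X]/s iteriS in_cons => ->; rewrite orbT.
have ujs j : u j \notin s j by have [] := fP (j, s j).
exists u => [i j uij|j]; last by have [] := fP (j, s j).
have [ij|ji|//] := ltngtP i j.
  by have := ujs j; rewrite -uij us.
by have := ujs i; rewrite uij us.
Qed.

(** The entropies increase to [b] without reaching it, whereas both the mesh of [W] and the rate of
    [S j] in [W] tend to 0: at any fixed scale the growth of the [S j] eventually becomes
    negligible. *)
Definition tail_sequence (b : R) x (p : nat -> X) (S : nat -> set X) : Prop :=
  forall j, [/\ compact (S j), p j != x, limit_point (S j) `<=` [set p j],
    htop (S j) = (b * (1 - t_ j))%:E &
    [/\ S j `<=` ball x (t_ j),
        (forall y, S j y -> forall g, g \in F j -> ball (act g x) (t_ j) (act g y)) &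
        exists W, [/\ covers W, small_mesh W (t_ j) & forall m,
          (ncov W (F m) (S j))%:R <= 1 + m%:R * expR (t_ j * #|` F m|%:R)]]].

Lemma exists_tail_sequence (b : R) : 0 < b ->
  hereditarily_uniformly_lowerable R act F ->
  (forall V, open_cover V -> exists2 U, open_cover U &
     ~ (\forall n \near \oo, (ncond U V n)%:R <= expR (2 * b * #|` F n|%:R))) ->
  exists x p S, tail_sequence b x p S.
Proof.
move=> b0 hul tail.
have tj0 j : 0 < t_ j by rewrite invr_gt0.
have /choice[V VP] : forall j, exists V : {fset set X}, open_cover V /\ small_mesh V (t_ j).
  by move=> j; have [V Vc Vm] := exists_small_mesh X_compact (tj0 j); exists V.
have [u u_inj uP] : exists2 u : nat -> X, injective u &
    forall j, exists2 U, open_cover U & tail_point act F U (V j) b (u j).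
  apply: (@exists_injective_sequence (fun j x => exists2 U, open_cover U &
    tail_point act F U (V j) b x)) => j Q; have [Vc _] := VP j.
  have [U Uc hU] := tail _ Vc.
  have [|x xQ xt] := exists_tail_point X_compact actM act_cont F_folner F_homo F_large
    Q Uc (ltW b0) _ hU; first lra.
  by exists x => //; exists U.
have [x xP] := compact_subsequence_point u X_compact.
have [N0 hN0] : exists N0, forall n, (N0 <= n)%N -> u n != x.
  have [[m mx]|no] := pselect (exists m, u m = x).
    by exists m.+1 => n mn; apply: contraTneq mn; rewrite -mx => /u_inj ->; rewrite ltnn.
  by exists 0%N => n _; apply/eqP => nx; apply: no; exists n.
suff /choice[p /choice[S pS]] : forall j, exists p S,
  [/\ compact S, p != x, limit_point S `<=` [set p],
    htop S = (b * (1 - t_ j))%:E &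
    [/\ S `<=` ball x (t_ j),
        (forall y, S y -> forall g, g \in F j -> ball (act g x) (t_ j) (act g y)) &
        exists W, [/\ covers W, small_mesh W (t_ j) & forall m,
          (ncov W (F m) S)%:R <= 1 + m%:R * expR (t_ j * #|` F m|%:R)]]].
  by exists x, p, S.
move=> j; have [r r0 orb] := orbit_ball act_cont (F j) x (tj0 j).
pose r' := Num.min r (t_ j); have r'0 : 0 < r' by rewrite lt_min r0/=.
have r2 : 0 < r' / 2 by rewrite divr_gt0.
(* Taking [k >= N0] makes [u k] distinct from [x], and [k >= j] brings the mesh of [V k] below
   [t_ j]. *)
have [k + ux] := xP (r' / 2) (maxn j N0) r2; rewrite geq_max => /andP[jk N0k].
have [U Uc Ut] := uP k; have [Vc Vm] := VP k.
have [K [Kco K0 Kball Klim [Kb Kcov]]] := exists_tail_set X_compact act_cont F_folner F_homo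
  F_large Uc Vc b0 (tj0 j) r2 Ut.
have tj1 : t_ j <= 1 by rewrite invf_le1 ?ler1n.
have h0 : 0 <= b * (1 - t_ j) by rewrite mulr_ge0 ?subr_ge0// ltW.
have hb : b * (1 - t_ j) <= b by rewrite -[leRHS]mulr1 ler_pM2l// gerBl ltW.
have [||S [Sco S0 SK Slim Sh]] := hul K Kco K0 (b * (1 - t_ j))%:E.
- by rewrite lee_fin.
- by apply: le_trans Kb; rewrite lee_fin.
have Sball y : S y -> ball x r' y.
  by move=> /SK/Kball ky; have := ball_triangle ux ky; rewrite -splitr.
exists (u k), S; split=> //.
- exact: hN0.
- move=> z Sz; apply: Klim => A /Sz[y [yz Sy Ay]]; exists y; split=> //; exact: SK.
split.
- by move=> y /Sball; apply: le_ball; rewrite ge_min lexx orbT.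
- by move=> y /Sball xy; apply: orb; move: xy; apply: le_ball; rewrite ge_min lexx.
exists (V k); split.
- exact: open_cover_covers.
- move=> A /Vm[y Ay h]; exists y => // z z' Az Az'.
  by have := h z z' Az Az'; apply: le_ball; rewrite lef_pV2 ?posrE// ler_nat.
move=> m; apply: le_trans (Kcov m).
by rewrite ler_nat; apply: ncov_sub => //; exact: open_cover_covers.
Qed.

(* A subset of [K] with one limit point either avoids all but finitely many of the
   [S j], or meets each of them in a finite set. *)
Lemma tail_sequence_not_lowerable (b : R) x p S : 0 < b ->
  tail_sequence b x p S -> ~ hereditarily_uniformly_lowerable R act F.
Proof.
move=> b0 tS hul.
have Sx i : S i `<=` ball x (t_ i) by have [_ _ _ _ []] := tS i.
have Sco i : compact (S i) by have [] := tS i.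
pose K := [set x] `|` \bigcup_i S i.
have Kco : compact K by exact: compact_null_union.
have tj0 j : 0 < t_ j by rewrite invr_gt0.
have tj1 j : t_ j <= 1 by rewrite invf_le1 ?ler1n.
have bK : (b%:E <= htop K)%E.
  rewrite leNgt; apply/negP => Kb.
  have fK : htop K = (fine (htop K))%:E.
    by rewrite fineK// ge0_fin_numE ?htop_ge0// (lt_trans Kb)// ltry.
  move: Kb; rewrite fK lte_fin => Kb.
  have d0 : 0 < (b - fine (htop K)) / (2 * b) by rewrite divr_gt0 ?subr_gt0// mulr_gt0.
  have [j /(_ j (leqnn j))] := inv_succ_le d0; rewrite ler_pdivlMr ?mulr_gt0// => hj.
  have : (htop (S j) <= htop K)%E.
    by apply: htop_sub => // y Sy; right; exists j.
  have [_ _ _ -> _] := tS j; rewrite fK lee_fin.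
  move: (t_ j) hj => a ha; lra.
have [|L [Lco L0 LK Llim Lb]] := hul K Kco (ex_intro _ x (or_introl erefl)) b%:E _ bK.
  by rewrite lee_fin ltW.
(* If [x] is not a limit point of [L], then [L] lies, up to [x], in finitely many [S i], so its
   entropy is at most [b * (1 - t_ N)], which is less than [b]. *)
have [xL|] := pselect (limit_point L x); last first.
  rewrite not_limit_pointE => -[A /nbhs_ballP[r r0 rA] LA].
  have [N hN] := near_null_sequence Sx r0.
  have Lsub : L `<=` [set x] `|` \big[setU/set0]_(i < N) S i.
    move=> y Ly; have [->|[i _ Siy]] := LK y Ly; first by left.
    have [Ni|iN] := leqP N i.
      by left; apply: LA; split=> //; apply: rA; exact: hN Siy.
    by right; rewrite -bigcup_mkord; exists i.
  have c0 : 0 <= b * (1 - t_ N) by rewrite mulr_ge0 ?subr_ge0// ltW.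
  have : (htop L <= (b * (1 - t_ N))%:E)%E.
    apply: (@le_trans _ _ (htop ([set x] `|` \big[setU/set0]_(i < N) S i))).
      exact: htop_sub.
    apply: htop_setU_le => //.
      by rewrite htop_set1// lee_fin.
    have : forall i : 'I_N, (htop (S i) <= (b * (1 - t_ N))%:E)%E.
      move=> i; have [_ _ _ -> _] := tS i; rewrite lee_fin ler_pM2l// lerB//.
      by rewrite lef_pV2 ?posrE// ler_nat ltnS ltnW.
    move=> hi; elim/big_ind : _ => // [|A1 A2 h1 h2]; last exact: htop_setU_le.
    apply: (@le_trans _ _ (htop [set x])); last by rewrite htop_set1// lee_fin.
    by apply: htop_sub => // ? [].
  by rewrite Lb lee_fin leNgt -[ltRHS]mulr1 ltr_pM2l// gtrBl tj0.
(* Now [x] is the only limit point of [L], whereas a limit point of the trace of [L] on [S i] would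
   be [p i], distinct from [x]. *)
have Lfin i : finite_set (L `&` S i).
  apply: contrapT => inf.
  have LSco : compact (L `&` S i).
    apply: (subclosed_compact _ Lco) => [|y []//].
    by apply: closedI; apply: compact_closed => //; exact: metric_hausdorff.
  have [z _ zlim] := infinite_limit_point LSco inf.
  have zL : limit_point L z.
    by move=> A /zlim[y [yz [Ly _] Ay]]; exists y.
  have zS : limit_point (S i) z.
    by move=> A /zlim[y [yz [_ Sy] Ay]]; exists y.
  have [_ /eqP px /(_ z zS) zp _ _] := tS i.
  by apply: px; rewrite -zp; exact: Llim.
have Lsub : L `<=` [set x] `|` \bigcup_i (L `&` S i).
  by move=> y Ly; have [->|[i _ Siy]] := LK y Ly; [left|right; exists i].
suff : (htop L <= 0%:E)%E by rewrite Lb lee_fin leNgt b0.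
apply: htop_le => // U Uc h h0.
have [rho rho0 Urho] := exists_lebesgue_number X_compact Uc.
have h20 : 0 < h / 2 by rewrite divr_gt0.
have mn0 : 0 < Num.min rho (h / 2) by rewrite lt_min rho0.
have [N tN] := inv_succ_le mn0.
have UT := open_cover_covers Uc.
have hlt : h / 2 < h by lra.
have Sorb i y : (L `&` S i) y ->
    forall g, g \in F i -> ball (act g x) (t_ i) (act g y).
  by move=> [_ Sy]; have [_ _ _ _ [_ H _]] := tS i; exact: H.
(* For [i >= N] the mesh of [W] is at most [rho], so that [W] refines [U], and the rate in [W] is at
   most [h / 2]. *)
have bnd i m : (N <= i)%N ->
    (ncov U (F m) (L `&` S i))%:R <= 1 * m.+1%:R * expR (h / 2 * #|` F m|%:R).
  move=> Ni; have [_ _ _ _ [_ _ [W [WT Wm hW]]]] := tS i.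
  have tle := tN i Ni.
  have WU : refines W U.
    apply: small_mesh_refines Wm _; apply: lebesgue_numberS Urho.
    by apply: le_trans tle _; rewrite ge_min lexx.
  apply: (@le_trans _ _ (ncov W (F m) (S i))%:R).
    rewrite ler_nat; apply: leq_trans (ncov_refines act _ _ WT WU) _.
    by apply: ncov_sub => // y [].
  apply: le_trans (hW m) _.
  have ile : expR (t_ i * #|` F m|%:R) <= expR (h / 2 * #|` F m|%:R).
    by rewrite ler_expR ler_wpM2r// (le_trans tle)// ge_min lexx orbT.
  have := expR_card_ge1 F m (ltW h20).
  have : m%:R * expR (t_ i * #|` F m|%:R) <= m%:R * expR (h / 2 * #|` F m|%:R).
    by rewrite ler_wpM2l.
  by rewrite mul1r -[m.+1%:R]natr1 mulrDl mul1r; lra.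
have := null_union_growth X_compact F_homo F_growth F_large
  Uc ler01 (ltW h20) Lfin Sorb bnd hlt.
apply: filterS => m; apply: le_trans.
by rewrite ler_nat ncov_sub.
Qed.

End Converse.

(** * Growth of the Folner sets and the equivalence *)

Lemma folner_growth (R : realType) (G : groupType) (F : nat -> {fset G}) :
  (fun n => #|` F n|%:R / ln n.+1%:R : R) @ \oo --> +oo ->
  forall e : R, 0 < e -> \forall n \near \oo, n.+1%:R <= expR (e * #|` F n|%:R).
Proof.
(* The index starts at 0, so [ln n.+1] is positive only from [n = 1] on. *)
move=> /cvgryPge F_log e e0; apply: filterS2 (F_log e^-1) (nbhs_infty_ge 1) => n hn n1.
have ln0 : 0 < ln n.+1%:R :> R by rewrite ln_gt0// ltr1n ltnS.
move: hn; rewrite ler_pdivlMr// ler_pdivrMl// => hn.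
by rewrite -[leLHS]lnK ?posrE// ler_expR.
Qed.

Lemma growth_large (R : realType) (G : groupType) (F : nat -> {fset G}) :
  (forall e : R, 0 < e -> \forall n \near \oo, n.+1%:R <= expR (e * #|` F n|%:R)) ->
  forall B : R, \forall n \near \oo, B <= #|` F n|%:R.
Proof.
move=> /(_ 1 ltr01) Fg B.
apply: filterS2 Fg (nbhs_infty_ge (Num.truncn (expR B)).+1) => n; rewrite mul1r => hn Bn.
rewrite -ler_expR; apply: le_trans hn; apply: ltW; apply: lt_trans (truncnS_gt _) _.
by rewrite ltr_nat ltnS.
Qed.

Theorem theorem1p4 (R : realType) (G : groupType) (X : metricType R)
    (act : G -> X -> X) (F : nat -> {fset G})
    (X_compact : compact [set: X])
    (G_countably_infinite : ([set: G] #= [set: nat])%card)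
    (G_amenable : amenable R G)
    (act_continuous : continuous_action act)
    (F_folner : folner R F)
    (F_tempered : tempered R F)
    (F_unit : 1%g \in F 0%N)
    (F_incr : forall n, (F n `<=` F n.+1)%fset)
    (F_log : (fun n => #|` F n|%:R / ln n.+1%:R : R) @ \oo --> +oo)
    (F_ratio : (fun n => #|` F n.+1|%:R / #|` F n|%:R : R) @ \oo --> (1 : R))
    (F_exhaust : \bigcup_n [set` F n] = [set: G]) :
  asymptotically_h_expansive R act F <->
  hereditarily_uniformly_lowerable R act F.
Proof.
have [_ actM act_cont] := act_continuous.
have F_homo m n : (m <= n)%N -> (F m `<=` F n)%fset.
  move=> /subnK <-; elim: (n - m)%N => [|k IHk]; first exact: fsubset_refl.
  exact: fsubset_trans IHk (F_incr _).
have F_growth := folner_growth F_log.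
have F_large := growth_large F_growth.
rewrite (asymptotically_h_expansiveP actM F_folner F_homo F_large).
split=> [tail0 K Kco [x0 Kx0] h h0 hK|hul t t0].
  (* Vanishing tail entropy makes [htop K] finite: the cover [V] attached to the rate 1 bounds it by
     1 plus [ln] of the size of [V], increased by one in case [V] is empty. *)
  have hfin : h = (fine h)%:E.
    rewrite fineK// ge0_fin_numE//; apply: le_lt_trans hK _.
    have [V Vc Vtail] := tail0 1 ltr01.
    apply: (@le_lt_trans _ _ (ln (#|` V|.+1)%:R + 1)%:E); last exact: ltry.
    apply: htop_le => // [|U Uc h' hh']; first by rewrite addr_ge0// ln_ge0// ler1n.
    have [UT VT] := (open_cover_covers Uc, open_cover_covers Vc).
    apply: filterS (Vtail U Uc) => n hn.
    apply: (@le_trans _ _ (expR ((ln (#|` V|.+1)%:R + 1) * #|` F n|%:R))); last first.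
      by rewrite ler_expR ler_wpM2r// ltW.
    rewrite mulrDl expRD expRM_natr lnK ?posrE//.
    apply: le_trans (ler_pM _ _ (_ : (ncov act V (F n) K)%:R <= _) hn) => //.
      by rewrite -natrM ler_nat ncov_le_mul_cond.
    rewrite -natrX ler_nat; apply: leq_trans (ncov_le_exp _ _ _ VT) _.
    by rewrite leq_exp2r// cardfs_gt0; case: F_folner.
  (* For [h = 0] a single point serves; positive [h] are left to [lowering_subset]. *)
  move: h0 hK; rewrite hfin lee_fin le_eqVlt => /predU1P[<- _|h0 hK].
    exists [set x0]; split.
    - exact: compact_set1.
    - by exists x0.
    - by move=> _ ->.
    - have := @limit_point_null_union R X x0 (fun=> set0).
      rewrite bigcup0// setU0 => lim y z.
      have {}lim : limit_point [set x0] `<=` [set x0].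
        by apply: lim => [i y0 []|i]; exact: finite_set0.
      by move=> /lim -> /lim ->.
    - exact: htop_set1.
  have tj0 (j : nat) : 0 < (j.+1%:R^-1 : R) by rewrite invr_gt0.
  have /choice[V VP] : forall j : nat, exists V : {fset set X}, open_cover V /\
      forall U, open_cover U -> \forall n \near \oo,
        (cond_cover_num (dyn_join act U (F n)) (dyn_join act V (F n)))%:R
          <= expR (j.+1%:R^-1 * #|` F n|%:R) :> R.
    by move=> j; have [V ? ?] := tail0 _ (tj0 j); exists V.
  exact: (lowering_subset X_compact act_cont F_folner F_homo F_growth F_large
    (fun j => (VP j).1) (fun j => (VP j).2)).
(* The rate is halved because tail points are found only at rates strictly below the one at which
   the tail bound fails. *)
apply: contrapT => no; have t2 : 0 < t / 2 by rewrite divr_gt0.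
have [V Vc|x [p [S tS]]] := exists_tail_sequence X_compact actM act_cont F_folner F_homo
  F_large t2 hul.
  apply: contrapT => noU; apply: no; exists V => // U Uc; apply: contrapT => nn.
  by apply: noU; exists U => //; rewrite (_ : 2 * (t / 2) = t)//; lra.
exact: (tail_sequence_not_lowerable X_compact F_folner F_homo F_growth F_large t2 tS).
Qed.
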